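(* The following hold for border ranks of matrix multiplication tensors. (1) $\underline{\mathbf{R}}(M_{\langle 2,3,3\rangle})=14$. (2) For $4\le n\le 24$ one has $\underline{\mathbf{R}}(M_{\langle 2,n,n\rangle})\ge \beta(n)$, where $\beta(4)=22$, $\beta(5)=32$, $\beta(6)=44$, $\beta(7)=58$, $\beta(8)=75$, $\beta(9)=93$, $\beta(10)=114$, $\beta(11)=136$, $\beta(12)=161$, $\beta(13)=187$, $\beta(14)=216$, $\beta(15)=246$, $\beta(16)=278$, $\beta(17)=312$, $\beta(18)=348$, $\beta(19)=387$, $\beta(20)=427$, $\beta(21)=470$, $\beta(22)=514$, $\beta(23)=561$, $\beta(24)=609$. (3) For every real $\epsilon$ with $0<\epsilon<\frac14$ and every positive integer $n$ with $$n>\frac{6}{\epsilon}\cdot\frac{3\sqrt6+6-\epsilon}{6\sqrt6-\epsilon},$$ one has $\underline{\mathbf{R}}(M_{\langle 2,n,n\rangle})\ge n^2+(3\sqrt6-6-\epsilon)n+1$. In particular, $\underline{\mathbf{R}}(M_{\langle 2,n,n\rangle})\ge n^2+1.32\,n+1$ for all integers $n\ge 25$.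
   Context: All vector spaces are over $\mathbb{C}$. A tensor $T\in A\otimes B\otimes C$ has rank one if $T=a\otimes b\otimes c$ for nonzero $a\in A$, $b\in B$, $c\in C$. The border rank $\underline{\mathbf{R}}(T)$ is the smallest $r$ such that $T$ is a limit of sums of $r$ rank one tensors. The matrix multiplication tensor $M_{\langle u,v,w\rangle}\in \mathbb{C}^{uv}\otimes\mathbb{C}^{vw}\otimes\mathbb{C}^{wu}$ is $\sum_{i=1}^{u}\sum_{j=1}^{v}\sum_{k=1}^{w} x^i_j\otimes y^j_k\otimes z^k_i$, where $\{x^i_j\}$, $\{y^j_k\}$, $\{z^k_i\}$ are bases of the three factors. *)

(* Defs.v *)
From mathcomp Require Import all_boot all_order all_algebra.
From mathcomp Require Export complex.
From mathcomp Require Import all_classical all_reals topology normedtype.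

Set Implicit Arguments.
Unset Strict Implicit.
Unset Printing Implicit Defensive.

Import Order.TTheory GRing.Theory Num.Theory.
Import numFieldNormedType.Exports.
Local Open Scope classical_set_scope.
Local Open Scope ring_scope.

(* Tensors in K^I (x) K^J (x) K^L, written in coordinates. The base field is
   any numFieldType K with the topology of its norm, so that it can be
   instantiated by R[i] for R a realType, i.e. by the complex numbers. *)
Notation tensor K I J L := {ffun I * J * L -> K}.

Section Tensors.
Variables (K : numFieldType) (I J L : finType).

Definition tprod (a : {ffun I -> K}) (b : {ffun J -> K}) (c : {ffun L -> K}) :
  tensor K I J L := [ffun t : I * J * L => a t.1.1 * b t.1.2 * c t.2].

Definition rank_one (T : tensor K I J L) : Prop :=
  exists a b c, [/\ a != 0, b != 0, c != 0 & T = tprod a b c].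

Definition sum_of_rank_one (r : nat) (T : tensor K I J L) : Prop :=
  exists S : 'I_r -> tensor K I J L,
    (forall p, rank_one (S p)) /\ T = \sum_(p < r) S p.

(* Convergence in the finite-dimensional space of tensors is convergence of
   every coordinate. *)
Definition limit_of_rank (r : nat) (T : tensor K I J L) : Prop :=
  exists S : nat -> tensor K I J L,
    (forall m, sum_of_rank_one r (S m)) /\
    (forall t, S m t @[m --> \oo] --> T t).

End Tensors.

Definition basis_vec (K : numFieldType) (I : finType) (i : I) : {ffun I -> K} :=
  [ffun i' => (i' == i)%:R].

Lemma limit_of_rank_exists (K : numFieldType) (I J L : finType)
  (T : tensor K I J L) : exists r, `[< limit_of_rank r T >].
Proof.
pose A := [set t | T t != 0]%SET.
exists #|A|; apply/asboolP; exists (fun=> T); split; last first.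
  by move=> t; exact: cvg_cst.
move=> _.
pose e (t : I * J * L) :=
  tprod [ffun i => T t * basis_vec K t.1.1 i] (basis_vec K t.1.2)
        (basis_vec K t.2).
have b0 (X : finType) (x : X) : basis_vec K x != 0.
  apply/eqP => /ffunP /(_ x); rewrite !ffunE eqxx => /eqP.
  by rewrite oner_eq0.
exists (fun p => e (enum_val p)); split.
  move=> p; eexists; eexists; eexists; split; last by [].
  - apply/eqP => /ffunP /(_ (enum_val p).1.1); rewrite !ffunE eqxx mulr1.
    by apply/eqP; have := enum_valP p; rewrite inE.
  - exact: b0.
  - exact: b0.
have <- : \sum_(t in A) e t = \sum_(p < #|A|) e (enum_val p).
  by rewrite big_enum_val.
apply/ffunP => -[[i j] l].
rewrite sum_ffunE /e.
transitivity (\sum_(t in A) if t == (i, j, l) then T t else 0).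
  rewrite -big_mkcondr /=; have [h|h] := boolP ((i, j, l) \in A).
    rewrite (big_pred1 (i, j, l)) // => t /=.
    by case: eqP => [->|]; rewrite ?h ?andbF.
  rewrite big_pred0; first by move: h; rewrite inE negbK => /eqP.
  by move=> t; case: eqP => [->|]; rewrite ?(negbTE h) ?andbF.
apply: eq_bigr => -[[i' j'] l'] _; rewrite !ffunE /=.
rewrite !xpair_eqE !(eq_sym i) !(eq_sym j) !(eq_sym l).
by case: (i' == i); case: (j' == j); case: (l' == l);
  rewrite ?(mulr1, mulr0, mul0r).
Qed.

Definition border_rank (K : numFieldType) (I J L : finType)
  (T : tensor K I J L) : nat := ex_minn (limit_of_rank_exists T).

(* M_<u,v,w> in the standard bases x^i_j, y^j_k, z^k_i. *)
Definition matmul (K : numFieldType) (u v w : nat) :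
  tensor K ('I_u * 'I_v)%type ('I_v * 'I_w)%type ('I_w * 'I_u)%type :=
  \sum_(i < u) \sum_(j < v) \sum_(k < w)
    tprod (basis_vec K (i, j)) (basis_vec K (j, k)) (basis_vec K (k, i)).

(* The values beta(4), ..., beta(24); meaningful only for 4 <= n <= 24. *)
Definition beta (n : nat) : nat :=
  nth 0%N [:: 22; 32; 44; 58; 75; 93; 114; 136; 161; 187; 216; 246; 278; 312;
            348; 387; 427; 470; 514; 561; 609]%N (n - 4)%N.

(* Main.v *)
Require Import Defs.
From HB Require Import structures.
From Stdlib Require Import ZArith.
From mathcomp Require Import all_boot all_order all_algebra.
From mathcomp Require Import all_classical all_reals topology normedtype.
From mathcomp Require Import zify ring lra.

Set Implicit Arguments.
Unset Strict Implicit.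
Unset Printing Implicit Defensive.

Import Order.TTheory GRing.Theory Num.Theory.
Import numFieldNormedType.Exports.
Local Open Scope ring_scope.

(** The lower bounds come from border apolarity, made elementary. Let [T] be the
    matrix multiplication tensor of format [2, n, n], a limit of sums of [r] rank
    one tensors with factors [a_p, b_p, c_p]. The slices of such a sum in the middle
    factor lie in the span of the [a_p c_p]; a subset of [s <= r] of these vectors is
    a basis of the span, and the same subset makes the tensors [a_p a_p c_p], the
    tensors [a_p c_p c_p] and the tensors [a_p c_p a_p c_p] independent. So the
    span has dimension [s], contains the slices, and admits [s] independent
    prolongations of three kinds, the first kind being the elements of the product
    of [S^2 A] and [C] whose slices lie in the span. By compactness of the
    Grassmannian ([limit_space_exists]) all this survives in the limit, where the
    span becomes a space [E] that contains the slices of [T]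
    ([border_apolarity]).

    The symmetries of [T] act on the spaces with these properties. Instead of the
    Borel fixed point theorem, [borel_fixed] takes such a space of minimal height:
    degenerating by a torus keeps the properties and the height, and a unipotent
    element that lowers weights could only decrease the height, hence fixes the
    space. A vector of [E] is an array of [n * n] blocks of size 2. Being fixed
    and homogeneous, [E] is described by a diagram of levels from 0 to 3, one for
    each block and nonincreasing along rows and columns, which says how much of sl_2
    occurs in the block besides the identity ([apolar_levels]). If [rho] is the sum
    of the levels, then [n * n + rho <= s], while the number of prolongations is at
    most a count made block by block: [count21] for pairs of blocks in a column,
    [count22] for quadruples of blocks. Transposing the diagram bounds the prolongations
    of the second kind. Hence [admissible], a purely combinatorial condition.

    It remains to see that [rho] is not small. The count for a row is a quadratic
    polynomial in the numbers of its entries of each level; [loss_ge0] bounds it by a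
    linear function of the total and of the first entry of the row. Summing over the
    rows gives [18 * n ^ 2 <= rho ^ 2 + (12 * n + 6) * rho] ([plain_bound]), so
    [rho] is essentially at least the positive root, which is asymptotically
    [(3 * sqrt 6 - 6) * n]. This yields the bound for every [n] with an error term
    [e], and the slope 1.32 from [n = 55] on. For smaller [n] rounding matters: a few
    pairs [(n, rho)] survive the inequality, and they are excluded by enumerating the
    diagrams ([check_sound]), most of which are cut off because their rows lose too
    much against the linear bound. For [n <= 6] the linear bound fails, and all
    diagrams are enumerated.

    The border rank for format [2, 3, 3] is at most 14 because of an explicit
    degeneration: fourteen products scaled by powers of a small parameter
    ([border_rank_233]). *)

(** * Function spaces on finite types *)

(** The functions take values in [F^o] because [F] itself is not a vector space. *)
Notation fsp F Z := {ffun Z -> F^o}.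

Section FunctionSpaces.
Variable F : fieldType.

(** Projections to weight components, evaluations at a point and
    transpositions are all of this form. *)
Definition pull (Z Z' : finType) (mu : Z' -> F) (phi : Z' -> Z) (f : fsp F Z)
  : fsp F Z' := [ffun z => mu z * f (phi z)].

Lemma pull_is_linear (Z Z' : finType) (mu : Z' -> F) (phi : Z' -> Z) : linear (@pull Z Z' mu phi).
Proof.
move=> c f g; apply/ffunP => z; rewrite !ffunE mulrDr; congr (_ + _).
by rewrite [LHS]mulrCA.
Qed.
HB.instance Definition _ (Z Z' : finType) (mu : Z' -> F) (phi : Z' -> Z) :=
  GRing.isLinear.Build F (fsp F Z) (fsp F Z') *:%R (@pull Z Z' mu phi)
    (@pull_is_linear Z Z' mu phi).

Definition kop (Z : finType) (k : Z -> Z -> F) (f : fsp F Z) : fsp F Z :=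
  [ffun z => \sum_z' k z z' * f z'].

Lemma kop_is_linear (Z : finType) (k : Z -> Z -> F) : linear (@kop Z k).
Proof.
move=> c f g; apply/ffunP => z; rewrite !ffunE.
rewrite [X in _ = X + _]mulr_sumr -big_split /=; apply: eq_bigr => z' _.
by rewrite !ffunE mulrDr; congr (_ + _); rewrite [LHS]mulrCA.
Qed.
HB.instance Definition _ (Z : finType) (k : Z -> Z -> F) :=
  GRing.isLinear.Build F (fsp F Z) (fsp F Z) *:%R (@kop Z k)
    (@kop_is_linear Z k).

Lemma scale_fspE (Z : finType) (c : F) (f : fsp F Z) z : (c *: f) z = c * f z.
Proof. by rewrite ffunE. Qed.

Lemma sum_fspE (Z I : finType) (P : pred I) (v : I -> fsp F Z) z :
  (\sum_(i | P i) v i) z = \sum_(i | P i) v i z.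
Proof. by rewrite sum_ffunE. Qed.

(** Dimensions are only ever estimated: from below by independent elements,
    and from above, in [dim_le_determining], by coordinates on which a nonzero
    element cannot vanish. *)
Lemma dim_ge_indep (Z I : finType) (D : pred I) (v : I -> fsp F Z)
    (E : {vspace fsp F Z}) :
  (forall i, D i -> v i \in E) ->
  (forall c : I -> F, \sum_(i | D i) c i *: v i = 0 ->
     forall i, D i -> c i = 0) ->
  (#|D| <= \dim E)%N.
Proof.
move=> vE ind.
pose X := [tuple v (enum_val i) | i < #|D|].
have XE k : X`_k = if insub k is Some i then v (enum_val (i : 'I_#|D|)) else 0.
  case: insubP => [i lt_k <-|ge_k].
    by rewrite -[X`_i]tnth_nth tnth_mktuple.
  by rewrite nth_default // size_tuple leqNgt.
have frX : free X.
  apply/freeP => c; rewrite (eq_bigr (fun i => c i *: v (enum_val i))); last first.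
    by move=> i _; rewrite -tnth_nth tnth_mktuple.
  move=> s0 i.
  pose c' x := if [pick k | enum_val k == x] is Some k then c k else 0.
  have c'E k : c' (enum_val k) = c k.
    rewrite /c'; case: pickP => [k' /eqP/enum_val_inj -> //|/(_ k)].
    by rewrite eqxx.
  have := ind c' _ (enum_val i) (enum_valP i); rewrite c'E; apply.
  rewrite -[RHS]s0 big_enum_val /=.
  by apply: eq_bigr => k _; rewrite c'E.
rewrite -(size_tuple X) -(eqP (frX : \dim _ == _)).
apply: dimvS; apply/span_subvP => x /tnthP[i ->].
by rewrite tnth_mktuple; apply: vE; apply: (enum_valP i).
Qed.

Lemma dim_le_determining (Z : finType) (D : pred Z) (E : {vspace fsp F Z}) :
  (forall f, f \in E -> (forall z, D z -> f z = 0) -> f = 0) ->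
  (\dim E <= #|D|)%N.
Proof.
move=> det.
pose p := linfun (pull (fun z => (D z)%:R) id : fsp F Z -> fsp F Z).
have pE f z : p f z = (D z)%:R * f z by rewrite lfunE ffunE.
have /limg_dim_eq <- : (E :&: lker p = 0)%VS.
  apply/eqP; rewrite -subv0; apply/subvP => f /memv_capP[fE].
  rewrite memv_ker memv0 => /eqP pf0; apply/eqP; apply: det => // z Dz.
  by move/ffunP/(_ z): pf0; rewrite pE Dz mul1r ffunE.
pose dl (z : Z) : fsp F Z := [ffun z' => (z' == z)%:R].
apply: (@leq_trans (\dim <<map dl (enum D)>>)); last first.
  by rewrite (leq_trans (dim_span _)) // size_map cardE.
apply: dimvS; apply/subvP => _ /memv_imgP[f _ ->].
have -> : p f = \sum_(z | D z) f z *: dl z.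
  apply/ffunP => z; rewrite pE sum_fspE.
  have [Dz|nDz] := boolP (D z).
    rewrite (bigD1 z) //= big1 ?addr0 => [|z' /andP[_ /negPf z'z]].
      by rewrite scale_fspE ffunE eqxx mul1r mulr1.
    by rewrite scale_fspE ffunE eq_sym z'z mulr0.
  rewrite mul0r big1 // => z' Dz'; rewrite scale_fspE ffunE.
  by case: eqP nDz => [->|_]; rewrite ?Dz' ?mulr0.
apply: memv_suml => z Dz; apply: memvZ; apply: memv_span.
by apply: map_f; rewrite mem_enum.
Qed.

End FunctionSpaces.

(** * Initial subspaces *)

Section Weights.
Variables (F : fieldType) (Z : finType) (wt : Z -> nat).
Implicit Types (E : {vspace fsp F Z}) (f : fsp F Z).

Definition comp_ w : 'End(fsp F Z) := linfun (pull (fun z => (wt z == w)%:R) id).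
Definition low_ v : 'End(fsp F Z) := linfun (pull (fun z => (wt z < v)%N%:R) id).

Lemma compE w f z : comp_ w f z = if wt z == w then f z else 0.
Proof. by rewrite lfunE ffunE; case: eqP; rewrite ?mul1r ?mul0r. Qed.

Lemma lowE v f z : low_ v f z = if (wt z < v)%N then f z else 0.
Proof. by rewrite lfunE ffunE; case: leqP; rewrite ?mul1r ?mul0r. Qed.

Lemma comp_comp w w' f : comp_ w (comp_ w' f) = if w == w' then comp_ w f else 0.
Proof.
apply/ffunP => z; rewrite !compE.
case: (eqVneq w w') => [->|ww']; rewrite ?compE ?ffunE //.
  by case: eqP.
by case: eqP => // ->; rewrite (negPf ww').
Qed.

Definition above E v := (E :&: lker (low_ v))%VS.

Lemma aboveP E v f :
  reflect (f \in E /\ forall z, (wt z < v)%N -> f z = 0) (f \in above E v).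
Proof.
rewrite memv_cap memv_ker; apply: (iffP andP) => -[fE f0]; split=> //.
  by move=> z zv; move/eqP/ffunP/(_ z): f0; rewrite lowE zv ffunE.
by apply/eqP/ffunP => z; rewrite lowE [RHS]ffunE; case: leqP => // /f0.
Qed.

(** The components of lowest weight of the elements of [E] span the limit of
    [E] under the one-parameter group that acts on coordinates with weights
    [wt]; here this limit is taken algebraically. *)
Definition init_part E w := (comp_ w @: above E w)%VS.

Let W := (\max_z wt z).+1.

Definition init E := (\sum_(w < W) init_part E w)%VS.

Lemma wt_bound z : (wt z < W)%N.
Proof. by rewrite ltnS leq_bigmax. Qed.

Lemma init_partP E w f : f \in init_part E w ->
  exists2 g, g \in above E w & f = comp_ w g.
Proof. by move=> /memv_imgP[g gE ->]; exists g. Qed.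

Lemma mem_init E w f : f \in above E w -> comp_ w f \in init E.
Proof.
move=> fE; have [wW|Ww] := ltnP w W.
  by apply: subvP (sumv_sup (Ordinal wW) (erefl _) (subvv _)) _ _; apply: memv_img.
suff -> : comp_ w f = 0 by apply: mem0v.
apply/ffunP => z; rewrite compE ffunE; case: eqP => // zw.
by have := wt_bound z; rewrite zw ltnNge Ww.
Qed.

Lemma comp_init E w f : f \in init E -> comp_ w f \in init_part E w.
Proof.
move=> /memv_sumP[g gE ->]; rewrite linear_sum /=; apply: memv_suml => i _.
have [h hE ->] := init_partP (gE i isT).
rewrite comp_comp; case: eqP => [->|_]; last exact: mem0v.
exact: memv_img.
Qed.

Lemma init_part_init E w : (init_part E w <= init E)%VS.
Proof.
apply/subvP => f /init_partP[g gE ->]; exact: mem_init.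
Qed.

Lemma comp_sum f : f = \sum_(w < W) comp_ w f.
Proof.
apply/ffunP => z; rewrite sum_fspE (bigD1 (Ordinal (wt_bound z))) //= big1.
  by rewrite addr0 compE eqxx.
by move=> w /eqP wz; rewrite compE; case: eqP => // zw; case: wz; apply: val_inj.
Qed.

Lemma dim_init_part E w :
  (\dim (above E w.+1) + \dim (init_part E w) = \dim (above E w))%N.
Proof.
rewrite -(limg_ker_dim (comp_ w) (above E w)); congr (_ + _)%N; congr (\dim _).
apply/vspaceP => f; apply/aboveP/memv_capP => [[fE f0]|[/aboveP[fE f0]]].
  split; first by apply/aboveP; split=> // z zw; apply: f0; apply: ltnW.
  by rewrite memv_ker; apply/eqP/ffunP => z; rewrite compE ffunE;
     case: eqP => // zw; apply: f0; rewrite zw.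
rewrite memv_ker => /eqP c0; split=> // z; rewrite ltnS leq_eqVlt => /orP[/eqP zw|/f0 //].
by move/ffunP/(_ z): c0; rewrite compE zw eqxx ffunE.
Qed.

Lemma above0 E : above E 0 = E.
Proof. by apply/vspaceP => f; apply/aboveP/idP => [[]|]. Qed.

Lemma aboveW E : \dim (above E W) = 0.
Proof.
apply/eqP; rewrite dimv_eq0 -subv0; apply/subvP => f /aboveP[_ f0].
by rewrite memv0; apply/eqP/ffunP => z; rewrite f0 ?ffunE ?wt_bound.
Qed.

(** Passing to the initial space keeps the dimension: [init] is a direct sum
    whose summands are the successive quotients of the weight filtration. *)
Lemma dim_init E : \dim (init E) = \dim E.
Proof.
have dir : directv (\sum_(w < W) init_part E w).
  apply/directv_sumP => w _; apply/eqP; rewrite -subv0; apply/subvP => f.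
  move=> /memv_capP[/init_partP[g _ fg] /memv_sumP[h hE fh]].
  have : comp_ w f = f by rewrite fg comp_comp eqxx.
  rewrite {1}fh linear_sum /= big1 => [<-|i iw]; first exact: mem0v.
  have [h' _ ->] := init_partP (hE i iw).
  by rewrite comp_comp eq_sym; case: eqP => // /val_inj wi; rewrite wi eqxx in iw.
rewrite /init (directvP dir) /= -(big_mkord xpredT (fun w => \dim (init_part E w))).
suff H n : (\dim (above E n) + \sum_(0 <= w < n) \dim (init_part E w) = \dim E)%N.
  by have := H W; rewrite aboveW.
elim: n => [|n IHn]; first by rewrite big_geq // above0 addn0.
by rewrite big_nat_recr //= [(\sum_(_ <= _ < _) _ + _)%N]addnC addnA dim_init_part.
Qed.

Definition homogeneous E := forall w f, f \in E -> comp_ w f \in E.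

Lemma homogeneous_init E : homogeneous (init E).
Proof. by move=> w f /comp_init/(subvP (init_part_init _ _)). Qed.

Lemma above_init E v : (above (init E) v <= init (above E v))%VS.
Proof.
apply/subvP => f /aboveP[fE f0]; rewrite (comp_sum f); apply: memv_suml => w _.
have [wv|vw] := ltnP w v.
  suff -> : comp_ w f = 0 by apply: mem0v.
  by apply/ffunP => z; rewrite compE ffunE; case: eqP => // zw; rewrite f0 ?zw.
have [g /aboveP[gE g0] ->] := init_partP (comp_init w fE).
apply: mem_init; apply/aboveP; split=> //.
by apply/aboveP; split=> // z zv; apply: g0; apply: leq_trans zv vw.
Qed.

(** The height decreases when [E] is moved towards lower weights. A space of
    minimal height will play the part of a point of a closed orbit. *)
Definition height E := (\sum_(v < W) \dim (above E v))%N.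

Lemma height_init E : (height (init E) <= height E)%N.
Proof.
apply: leq_sum => v _; rewrite -(dim_init (above E v)); apply: dimvS.
exact: above_init.
Qed.

Variables (g h : 'End(fsp F Z)).
Hypothesis hK : cancel h g.
Hypothesis g_low : forall v f, (forall z, (v <= wt z)%N -> f z = 0) ->
  forall z, (v <= wt z)%N -> g f z = 0.
Hypothesis g_unip : forall w f, (forall z, wt z != w -> f z = 0) ->
  forall z, (w <= wt z)%N -> g f z = f z.

Let high v : 'End(fsp F Z) := linfun (pull (fun z => (v <= wt z)%N%:R) id).
Let highE v f z : high v f z = if (v <= wt z)%N then f z else 0.
Proof. by rewrite lfunE ffunE; case: leqP; rewrite ?mul1r ?mul0r. Qed.

Let mem_high E v f : homogeneous E -> f \in E -> high v f \in E.
Proof.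
move=> hE fE; have -> : high v f = \sum_(w < W | (v <= w)%N) comp_ w f.
  apply/ffunP => z; rewrite highE sum_fspE.
  have [vz|zv] := leqP v (wt z).
    rewrite (bigD1 (Ordinal (wt_bound z))) //= big1 ?addr0 ?compE ?eqxx // => w.
    by case/andP=> _ /eqP wz; rewrite compE; case: eqP => // zw; case: wz; apply: val_inj.
  rewrite big1 // => w vw; rewrite compE; case: eqP => // zw.
  by move: zv; rewrite zw ltnNge vw.
by apply: memv_suml => w _; apply: hE.
Qed.

(* Truncating [h f] to weights at least [v] loses no element of [g @: E] without
   components below [v], since [g] only lowers weights. *)
Let psi v := (high v \o h)%VF.

Let psi_inj E v : (above (g @: E) v :&: lker (psi v) = 0)%VS.
Proof.
apply/eqP; rewrite -subv0; apply/subvP => f /memv_capP[/aboveP[_ f0]].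
rewrite memv_ker comp_lfunE memv0 => /eqP/ffunP p0; apply/eqP/ffunP => z.
rewrite [RHS]ffunE; have [/f0 //|vz] := ltnP (wt z) v.
rewrite -(hK f); apply: (g_low (v := v)) => // z' vz'.
by have := p0 z'; rewrite highE vz' ffunE.
Qed.

Let psi_sub E v : cancel g h -> homogeneous E ->
  (psi v @: above (g @: E) v <= above E v)%VS.
Proof.
move=> gK hE; apply/subvP => _ /memv_imgP[f /aboveP[/memv_imgP[f' f'E ->] _] ->].
rewrite comp_lfunE gK; apply/aboveP; split; first exact: mem_high.
by move=> z zv; rewrite highE leqNgt zv.
Qed.

Lemma dim_above_img E v : cancel g h -> homogeneous E ->
  (\dim (above (g @: E) v) <= \dim (above E v))%N.
Proof.
by move=> gK hE; rewrite -(limg_dim_eq (psi_inj E v)) dimvS // psi_sub.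
Qed.

(** A unipotent automorphism [g] that lowers weights cannot increase the height.
    When it does not decrease the height either, the truncations [psi v] are
    isomorphisms; a homogeneous [f] in [E] is then the truncation of some [e] in
    [E] with [g e] free of low weights, which forces [g e = f]. *)
Lemma stable_of_minimal E : cancel g h -> homogeneous E ->
  (height E <= height (g @: E))%N ->
  forall w f, f \in E -> (forall z, wt z != w -> f z = 0) -> h f \in E.
Proof.
move=> gK hE min w f fE fw.
have [wW|Ww] := ltnP w W; last first.
  suff -> : f = 0 by rewrite linear0 mem0v.
  apply/ffunP => z; rewrite ffunE; apply: fw.
  by have := wt_bound z; rewrite neq_ltn => zW; rewrite (leq_trans zW Ww).
have eqd : \dim (above (g @: E) w) = \dim (above E w).
  apply/eqP; rewrite eqn_leq dim_above_img //=; move: min; rewrite /height.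
  rewrite (bigD1 (Ordinal wW)) //= [X in (_ <= X)%N -> _](bigD1 (Ordinal wW)) //=.
  have le := leq_sum (index_enum _) (P := fun i => i != Ordinal wW)
    (fun i _ => dim_above_img (nat_of_ord i) gK hE).
  by move: le; set a := (\sum_(i < _ | _) _)%N; set b := (\sum_(i < _ | _) _)%N; lia.
have : f \in (psi w @: above (g @: E) w)%VS.
  have /eqP -> : (psi w @: above (g @: E) w == above E w)%VS.
    by rewrite eqEdim psi_sub //= (limg_dim_eq (psi_inj E w)) eqd.
  apply/aboveP; split=> // z zw; apply: fw; by rewrite neq_ltn zw.
move=> /memv_imgP[f' /aboveP[/memv_imgP[e eE f'e] f'0]].
rewrite comp_lfunE f'e gK => fe.
suff -> : h f = e by [].
have -> : f = f'; last by rewrite f'e gK.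
apply/ffunP => z; have [zw|wz] := ltnP (wt z) w.
  by rewrite f'0 // fw // neq_ltn zw.
have -> : f z = g f z by rewrite (g_unip fw).
apply/eqP; rewrite f'e -subr_eq0.
have -> : g f z - g e z = g (f - e) z by rewrite linearB /= !ffunE.
apply/eqP; apply: (g_low (v := w)) => // z' wz'.
by rewrite !ffunE {1}fe highE wz' subrr.
Qed.

End Weights.
Arguments comp_ {F Z} wt w.

(** * Apolarity tests *)

(** Matrices are functions of two indices in arbitrary finite types, so that
    tensor products of operators need no reindexing. *)
Section Kernels.
Variable F : fieldType.

Definition kid (Z : finType) (z z' : Z) : F := (z == z')%:R.

Definition kmul (Z : finType) (k l : Z -> Z -> F) z z' : F :=
  \sum_y k z y * l y z'.

Definition kron (X Y : finType) (k : X -> X -> F) (l : Y -> Y -> F)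
  (z z' : X * Y) : F := k z.1 z'.1 * l z.2 z'.2.

Definition kinverse (Z : finType) (k k' : Z -> Z -> F) :=
  kmul k k' =2 @kid Z /\ kmul k' k =2 @kid Z.

Definition lowering (Z : finType) (wt : Z -> nat) (k : Z -> Z -> F) :=
  (forall z, k z z = 1) /\
  (forall z z', k z z' != 0 -> z = z' \/ (wt z < wt z')%N).

Lemma kop_kmul (Z : finType) (k l : Z -> Z -> F) f :
  kop k (kop l f) = kop (kmul k l) f.
Proof.
apply/ffunP => z; rewrite !ffunE; under eq_bigr do rewrite ffunE mulr_sumr.
rewrite exchange_big /=; apply: eq_bigr => z' _.
by rewrite /kmul mulr_suml; apply: eq_bigr => y _; rewrite mulrA.
Qed.

Lemma kop_kid (Z : finType) f : kop (@kid Z) f = f.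
Proof.
apply/ffunP => z; rewrite ffunE (bigD1 z) //= big1 ?addr0 /kid ?eqxx ?mul1r //.
by move=> z' /negPf zz'; rewrite eq_sym zz' mul0r.
Qed.

Lemma eq_kop (Z : finType) (k l : Z -> Z -> F) f : k =2 l -> kop k f = kop l f.
Proof.
by move=> kl; apply/ffunP => z; rewrite !ffunE; apply: eq_bigr => z' _; rewrite kl.
Qed.

Lemma kop_cancel (Z : finType) (k l : Z -> Z -> F) :
  kmul k l =2 @kid Z -> cancel (kop l) (kop k).
Proof. by move=> kl f; rewrite kop_kmul (eq_kop _ kl) kop_kid. Qed.

Lemma kmul_kron (X Y : finType) (k k' : X -> X -> F) (l l' : Y -> Y -> F) :
  kmul (kron k l) (kron k' l') =2 kron (kmul k k') (kmul l l').
Proof.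
move=> z z'; rewrite /kmul /kron mulr_suml.
rewrite [LHS](eq_bigr (fun y : X * Y =>
  (k z.1 y.1 * k' y.1 z'.1) * (l z.2 y.2 * l' y.2 z'.2))); last first.
  by move=> y _; rewrite mulrACA.
rewrite -(pair_bigA _ (fun x y =>
  (k z.1 x * k' x z'.1) * (l z.2 y * l' y z'.2))) /=.
by apply: eq_bigr => x _; rewrite mulr_sumr.
Qed.

Lemma kron_kid (X Y : finType) : kron (@kid X) (@kid Y) =2 @kid (X * Y)%type.
Proof. by move=> [x y] [x' y']; rewrite /kron /kid /= -natrM mulnb. Qed.

Lemma kinverse_kron (X Y : finType) (k k' : X -> X -> F) (l l' : Y -> Y -> F) :
  kinverse k k' -> kinverse l l' -> kinverse (kron k l) (kron k' l').
Proof.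
move=> [kk' k'k] [ll' l'l]; split=> z z'; rewrite kmul_kron -kron_kid /kron.
  by rewrite kk' ll'.
by rewrite k'k l'l.
Qed.

Lemma lowering_kron (X Y : finType) (wX : X -> nat) (wY : Y -> nat)
    (k : X -> X -> F) (l : Y -> Y -> F) :
  lowering wX k -> lowering wY l ->
  lowering (fun z => wX z.1 + wY z.2)%N (kron k l).
Proof.
move=> [k1 kl] [l1 ll]; split=> [z|[x y] [x' y']]; first by rewrite /kron k1 l1 mulr1.
rewrite /kron mulf_eq0 negb_or /= => /andP[/kl kx /ll ly].
case: kx ly => [->|xx'] [->|yy']; [by left | right; lia..].
Qed.

Lemma lowering_low (Z : finType) (wt : Z -> nat) (k : Z -> Z -> F) v (f : fsp F Z) :
  lowering wt k -> (forall z, (v <= wt z)%N -> f z = 0) ->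
  forall z, (v <= wt z)%N -> kop k f z = 0.
Proof.
move=> [_ kl] f0 z vz; rewrite ffunE big1 // => z' _.
case: (eqVneq (k z z') 0) => [->|/kl[<-|zz']]; rewrite ?mul0r // f0 ?mulr0 //.
by apply: leq_trans vz (ltnW _).
Qed.

Lemma lowering_unip (Z : finType) (wt : Z -> nat) (k : Z -> Z -> F) w (f : fsp F Z) :
  lowering wt k -> (forall z, wt z != w -> f z = 0) ->
  forall z, (w <= wt z)%N -> kop k f z = f z.
Proof.
move=> [k1 kl] f0 z wz; rewrite ffunE (bigD1 z) //= big1 ?addr0 ?k1 ?mul1r //.
move=> z' z'z; case: (eqVneq (k z z') 0) => [->|/kl[zz'|zz']].
- by rewrite mul0r.
- by rewrite zz' eqxx in z'z.
by rewrite f0 ?mulr0 // neq_ltn (leq_ltn_trans wz zz') orbT.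
Qed.

End Kernels.

Section Tests.
Variables (F : fieldType) (X Y : finType) (Sy : (X * Y -> X * Y) -> Prop).
Implicit Types (E : {vspace fsp F Y}) (Q : fsp F (X * Y)%type).

Definition slice x Q : fsp F Y := [ffun y => Q (x, y)].

(** When [Sy] exchanges two tensor factors [A], and [E] lies in the product of
    [A] and [C], these tensors form the intersection of the product of
    [S^2 A] and [C] with the product of [A] and [E]. *)
Definition prolongs E Q :=
  (forall p, Sy p -> forall z, Q (p z) = Q z) /\ (forall x, slice x Q \in E).

Definition test E s := exists K : {vspace fsp F (X * Y)%type},
  (s <= \dim K)%N /\ (forall Q, Q \in K -> prolongs E Q).

Lemma slice_is_linear x : linear (slice x).
Proof. by move=> c f g; apply/ffunP => z; rewrite !ffunE. Qed.
HB.instance Definition _ x :=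
  GRing.isLinear.Build F (fsp F (X * Y)%type) (fsp F Y) *:%R (slice x)
    (slice_is_linear x).

Lemma prolongs_sum (I : finType) (P : pred I) E (Q : I -> fsp F (X * Y)%type) :
  (forall i, P i -> prolongs E (Q i)) -> prolongs E (\sum_(i | P i) Q i).
Proof.
move=> QE; split=> [p sp z|x].
  by rewrite !sum_fspE; apply: eq_bigr => i /QE[sy _]; apply: sy.
by rewrite linear_sum; apply: memv_suml => i /QE[_ sl]; apply: sl.
Qed.

(** The initial space of a space of prolongations of [E] consists of
    prolongations of the initial space, and has the same dimension. *)
Lemma test_init (wX : X -> nat) (wY : Y -> nat) E s :
  (forall p, Sy p -> forall z,
     (wX (p z).1 + wY (p z).2 = wX z.1 + wY z.2)%N) ->
  test E s -> test (init wY E) s.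
Proof.
move=> syw [K [sK KE]]; pose wt (z : X * Y) := (wX z.1 + wY z.2)%N.
exists (init wt K); split=> [|Q QK]; first by rewrite dim_init.
rewrite (comp_sum wt Q); apply: prolongs_sum => w _.
have [P /aboveP[PK P0] ->] := init_partP (comp_init w QK).
have [sy sl] := KE P PK; split=> [p sp z|x].
  by rewrite !compE /wt syw // sy.
have [xw|wx] := leqP (wX x) w.
  have -> : slice x (comp_ wt w P) = comp_ wY (w - wX x)%N (slice x P).
    apply/ffunP => y; rewrite ffunE !compE ffunE /wt /=.
    by rewrite -{1}(subnKC xw) eqn_add2l.
  apply: mem_init; apply/aboveP; split=> // y yw.
  by rewrite ffunE P0 // /wt /= -ltn_subRL.
suff -> : slice x (comp_ wt w P) = 0 by apply: mem0v.
apply/ffunP => y; rewrite !ffunE compE /wt /=; case: eqP => // xyw.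
by move: wx; rewrite -xyw ltnNge leq_addr.
Qed.

(** Prolongations are transported by a change of basis acting on all factors in
    a way compatible with the symmetries. *)
Lemma test_img (k k' : X -> X -> F) (l l' : Y -> Y -> F) E s :
  kinverse k k' -> kinverse l l' ->
  (forall p, Sy p -> involutive p /\
     forall z z', kron k l (p z) (p z') = kron k l z z') ->
  test E s -> test (linfun (kop l) @: E) s.
Proof.
move=> kk' ll' syk [K [sK KE]].
have [_ invl] := kinverse_kron kk' ll'.
exists (linfun (kop (kron k l)) @: K)%VS; split.
  rewrite limg_dim_eq //; apply/eqP; rewrite -subv0; apply/subvP => Q.
  move=> /memv_capP[_]; rewrite memv_ker lfunE memv0 /= => /eqP Q0.
  by rewrite -(kop_cancel invl Q) Q0 linear0.
move=> _ /memv_imgP[Q QK ->]; rewrite lfunE /=; have [sy sl] := KE Q QK.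
split=> [p sp z|x].
  have [pI kp] := syk p sp.
  rewrite !ffunE (reindex_inj (inv_inj pI)) /=; apply: eq_bigr => z' _.
  by rewrite kp sy.
have -> : slice x (kop (kron k l) Q) = \sum_x' k x x' *: kop l (slice x' Q).
  apply/ffunP => y; rewrite !ffunE sum_fspE.
  rewrite (eq_bigr (fun z' : X * Y =>
    k x z'.1 * (l y z'.2 * Q (z'.1, z'.2)))); last first.
    by move=> [x' y'] _; rewrite /kron /= mulrA.
  rewrite -(pair_bigA _ (fun x' y' => k x x' * (l y y' * Q (x', y')))) /=.
  apply: eq_bigr => x' _; rewrite scale_fspE ffunE mulr_sumr.
  by apply: eq_bigr => y' _; rewrite ffunE.
apply: memv_suml => x' _; apply: memvZ.
have -> : kop l (slice x' Q) = linfun (kop l) (slice x' Q) by rewrite lfunE.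
by apply: memv_img.
Qed.

End Tests.

(** * Spaces of minimal height *)

Section Borel.
Variables (F : fieldType) (A C : finType).
Notation Y := (A * C)%type.
Implicit Types (E : {vspace fsp F Y}).

Definition swapA (z : A * Y) : A * Y := (z.2.1, (z.1, z.2.2)).
Definition swapC (z : C * Y) : C * Y := (z.2.2, (z.2.1, z.1)).
Definition swapYA (z : Y * Y) : Y * Y := ((z.2.1, z.1.2), (z.1.1, z.2.2)).
Definition swapYC (z : Y * Y) : Y * Y := ((z.1.1, z.2.2), (z.2.1, z.1.2)).

Definition test21 E s := test (eq swapA) E s.
Definition test12 E s := test (eq swapC) E s.
Definition test22 E s := test (fun p => p = swapYA \/ p = swapYC) E s.

(** What survives in the limit when a space spanned by [s] points [a_p] of [A]
    times [c_p] of [C], chosen independent, degenerates: the tensors with factors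
    [a_p, a_p, c_p], or [a_p, c_p, c_p], or [a_p, c_p, a_p, c_p], are independent
    too, and they prolong that space. [L] contains the vectors that the limit is
    known to contain. *)
Definition apolar (L : fsp F Y -> Prop) E s :=
  [/\ (\dim E <= s)%N, (forall f, L f -> f \in E), test21 E s, test12 E s &
      test22 E s].

Variables (wA : A -> nat) (wC : C -> nat) (L : fsp F Y -> Prop).
Let wY (y : Y) := (wA y.1 + wC y.2)%N.

Hypothesis L_comp : forall w f, L f -> L (comp_ wY w f).

Lemma apolar_init E s : apolar L E s -> apolar L (init wY E) s.
Proof.
move=> [dE LE t1 t2 t3]; split.
- by rewrite dim_init.
- move=> f Lf; rewrite (comp_sum wY f); apply: memv_suml => w _.
  have -> : comp_ wY w f = comp_ wY w (comp_ wY w f) by rewrite comp_comp eqxx.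
  apply: mem_init; apply/aboveP; split; first by apply/LE/L_comp.
  by move=> z zw; rewrite compE; case: eqP zw => // ->; rewrite ltnn.
- by apply: (test_init (wX := wA)) t1 => _ <- z; rewrite /wY /=; lia.
- by apply: (test_init (wX := wC)) t2 => _ <- z; rewrite /wY /=; lia.
- by apply: (test_init (wX := wY)) t3 => _ [->|->] z; rewrite /wY /=; lia.
Qed.

(** Group elements, given as kernels with their inverses on both factors. *)
Variable G : (A -> A -> F) -> (A -> A -> F) -> (C -> C -> F) -> (C -> C -> F) -> Prop.
Hypothesis G_inv : forall k k' l l', G k k' l l' -> kinverse k k' /\ kinverse l l'.
Hypothesis G_low : forall k k' l l', G k k' l l' -> lowering wA k /\ lowering wC l.
Hypothesis G_L : forall k k' l l', G k k' l l' ->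
  forall f, L f -> L (kop (kron k' l') f).

Lemma apolar_img k k' l l' E s : G k k' l l' ->
  apolar L E s -> apolar L (linfun (kop (kron k l)) @: E) s.
Proof.
move=> Gg [dE LE t1 t2 t3]; have [ik il] := G_inv Gg.
have ikl := kinverse_kron ik il.
split.
- by apply: leq_trans dE; rewrite -(limg_ker_dim (linfun (kop (kron k l))) E) leq_addl.
- move=> f /(G_L Gg)/LE; rewrite -{2}(kop_cancel (proj1 ikl) f).
  by move/(memv_img (linfun (kop (kron k l)))); rewrite lfunE.
- apply: (test_img ik ikl) t1 => _ <-; split=> [[a [a' c]] //|z z'].
  by rewrite /kron /= mulrCA.
- apply: (test_img il ikl) t2 => _ <-; split=> [[a [a' c]] //|z z'].
  by rewrite /kron /=; ring.
- apply: (test_img ikl ikl) t3 => _ [] ->.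
  + by split=> [[[a c] [a' c']] //|z z']; rewrite /kron /=; ring.
  + by split=> [[[a c] [a' c']] //|z z']; rewrite /kron /=; ring.
Qed.

(** Among the spaces satisfying the tests, one of minimal height is fixed by
    the group: this replaces the Borel fixed point theorem. *)
Theorem borel_fixed E s : apolar L E s -> exists E',
  [/\ apolar L E' s, homogeneous wY E' &
      forall k k' l l', G k k' l l' -> forall w f, f \in E' ->
        (forall z, wY z != w -> f z = 0) -> kop (kron k' l') f \in E'].
Proof.
have [n] := ubnP (height wY E).
elim: n E => // n IHn E hE aE.
have aI := apolar_init aE.
have hI := leq_ltn_trans (height_init wY E) hE.
have [[E' [hE' aE']]|min] := pselect (exists E',
  (height wY E' < height wY (init wY E))%N /\ apolar L E' s).
  by apply: IHn aE'; lia.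
exists (init wY E); split=> //; first exact: homogeneous_init.
move=> k k' l l' Gg w f fE fw.
have [ik il] := G_inv Gg; have [lk ll] := G_low Gg.
have [kk k'k] := kinverse_kron ik il.
have -> : kop (kron k' l') f = linfun (kop (kron k' l')) f by rewrite lfunE.
apply: (@stable_of_minimal F Y wY (linfun (kop (kron k l)))) fE fw.
- by move=> g; rewrite !lfunE; apply: kop_cancel.
- move=> v g g0 z; rewrite lfunE.
  exact: (lowering_low (lowering_kron lk ll)).
- move=> v g g0 z; rewrite lfunE.
  exact: (lowering_unip (lowering_kron lk ll)).
- by move=> g; rewrite !lfunE; apply: kop_cancel.
- exact: homogeneous_init.
rewrite leqNgt; apply/negP => lt; apply: min; eexists; split; first exact: lt.
exact: apolar_img Gg aI.
Qed.

End Borel.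

(** * Borel-fixed spaces and their levels *)

Lemma ord2E (i : 'I_2) : i = 0 \/ i = 1.
Proof. by case: i => [[|[|//]] i2]; [left | right]; apply: val_inj. Qed.

Lemma big_pairE R (idx : R) (op : Monoid.com_law idx) (X Y : finType)
    (G : X * Y -> R) :
  \big[op/idx]_z G z = \big[op/idx]_x \big[op/idx]_y G (x, y).
Proof. by rewrite pair_bigA; apply: eq_bigr => -[]. Qed.

Lemma card_sumE (T : finType) (D : pred T) : (#|D| = \sum_z D z)%N.
Proof.
by rewrite -sum1_card big_mkcond /=; apply: eq_bigr => z _; rewrite unfold_in; case: (D z).
Qed.

Section Transvections.
Variable F : fieldType.

Definition kadd (Z : finType) (i j : Z) (t : F) z z' : F :=
  kid F z z' + t * ((z == i) && (z' == j))%:R.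

Lemma sum_kid (Z : finType) z (g : Z -> F) : \sum_z' kid F z z' * g z' = g z.
Proof.
rewrite (bigD1 z) //= big1 ?addr0 /kid ?eqxx ?mul1r //.
by move=> z' /negPf zz'; rewrite eq_sym zz' mul0r.
Qed.

Lemma sum_kadd (Z : finType) (i j : Z) t z (g : Z -> F) :
  \sum_z' kadd i j t z z' * g z' = g z + t * (z == i)%:R * g j.
Proof.
rewrite (eq_bigr (fun z' => kid F z z' * g z' + t * ((z == i) && (z' == j))%:R * g z')).
  rewrite big_split /= sum_kid (bigD1 j) //= eqxx andbT big1 ?addr0 // => z' /negPf ->.
  by rewrite andbF mulr0 mul0r.
by move=> z' _; rewrite /kadd mulrDl.
Qed.

Lemma kinverse_kid (Z : finType) : kinverse (@kid F Z) (@kid F Z).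
Proof. by split=> z z'; rewrite /kmul sum_kid. Qed.

Lemma kinverse_kadd (Z : finType) (i j : Z) t : i != j ->
  kinverse (kadd i j t) (kadd i j (- t)).
Proof.
move=> ij; have ji : (j == i) = false by rewrite eq_sym (negPf ij).
split=> z z'; rewrite /kmul sum_kadd /kadd ji /= !mulr0 addr0 /kid [j == _]eq_sym -mulnb natrM;
  by ring.
Qed.

Lemma lowering_kid (Z : finType) (wt : Z -> nat) : lowering wt (@kid F Z).
Proof.
split=> [z|z z']; first by rewrite /kid eqxx.
by have [->|/negPf zz'] := eqVneq z z'; [left | rewrite /kid zz' eqxx].
Qed.

Lemma lowering_kadd (Z : finType) (wt : Z -> nat) (i j : Z) t :
  (wt i < wt j)%N -> lowering wt (kadd i j t).
Proof.
move=> ij; have ij' : i != j by apply: contraTneq ij => ->; rewrite ltnn.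
split=> [z|z z'].
  rewrite /kadd /kid eqxx; have [->|_] := eqVneq z i; last by rewrite mulr0 addr0.
  by rewrite (negPf ij') mulr0 addr0.
have [->|/negPf zz'] := eqVneq z z'; first by left.
rewrite /kadd /kid zz' add0r.
by have [->|_] := eqVneq z i; have [->|_] := eqVneq z' j; rewrite ?mulr0 ?eqxx //; right.
Qed.

Lemma sum_kron (X Y : finType) (k : X -> X -> F) (l : Y -> Y -> F)
    (f : X * Y -> F) x y :
  \sum_z kron k l (x, y) z * f z = \sum_x' k x x' * (\sum_y' l y y' * f (x', y')).
Proof.
rewrite (eq_bigr (fun z' : X * Y =>
    k x z'.1 * (l y z'.2 * f (z'.1, z'.2)))); last first.
  by move=> [x' y'] _; rewrite /kron /= mulrA.
rewrite -(pair_bigA _ (fun x' y' => k x x' * (l y y' * f (x', y')))) /=.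
by apply: eq_bigr => x' _; rewrite mulr_sumr.
Qed.

Lemma eq_lowering (Z : finType) (wt wt' : Z -> nat) (k : Z -> Z -> F) :
  wt =1 wt' -> lowering wt k -> lowering wt' k.
Proof. by move=> ww [k1 kl]; split=> // z z' /kl; rewrite !ww. Qed.

Lemma kop_kron (X Y : finType) (k : X -> X -> F) (l : Y -> Y -> F) f x y :
  kop (kron k l) f (x, y) = \sum_x' k x x' * (\sum_y' l y y' * f (x', y')).
Proof. by rewrite ffunE sum_kron. Qed.

End Transvections.

Section Levels.
Variables (F : fieldType) (n : nat).
Hypothesis F2 : 2%:R != 0 :> F.
Notation A := ('I_2 * 'I_n)%type.
Notation C := ('I_n * 'I_2)%type.
Notation Y := (A * C)%type.
Implicit Types (E : {vspace fsp F Y}) (f : fsp F Y).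

(** Coordinates are organised as an [n] by [n] array of blocks of size 2. The
    vectors [idv m] have multiples of the identity as blocks: they are the slices
    of the matrix multiplication tensor. *)
Definition idv (m : 'I_n -> 'I_n -> F) : fsp F Y :=
  [ffun y => (y.1.1 == y.2.2)%:R * m y.1.2 y.2.1].

Definition is_idv f := exists m, f = idv m.

Definition unitv (y0 : Y) : fsp F Y := [ffun y => (y == y0)%:R].

(** The four coordinates of the block [(j, k)] have weights [3 * (n * j + k)]
    plus 0, 1, 1, 2, so that a homogeneous vector lives in a single block, and the
    identity of a block is homogeneous. *)
Definition wA (x : A) : nat := (x.1 + 3 * n * x.2)%N.
Definition wC (x : C) : nat := (1 - x.2 + 3 * x.1)%N.
Definition wY (y : Y) : nat := (wA y.1 + wC y.2)%N.

Lemma is_idv_comp w f : is_idv f -> is_idv (comp_ wY w f).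
Proof.
case=> m ->.
exists (fun j k : 'I_n => if (1 + 3 * (n * j + k) == w)%N then m j k else 0).
apply/ffunP => -[[a j] [k c]]; rewrite compE !ffunE /= /wY /wA /wC /=.
have [<-|_] := eqVneq a c; last by rewrite !mul0r if_same.
have -> : (a + 3 * n * j + (1 - a + 3 * k) = 1 + 3 * (n * j + k))%N.
  by have := ltn_ord a; lia.
by case: ifP; rewrite ?mulr0 ?mul1r.
Qed.

(** Unipotent generators of the upper triangular changes of basis that preserve
    matrix multiplication: transvections of the rows of blocks, of the columns of
    blocks, and conjugation inside every block. *)
Inductive raising : (A -> A -> F) -> (A -> A -> F) -> (C -> C -> F) ->
    (C -> C -> F) -> Prop :=
| raise_row (i j : 'I_n) : (i < j)%N ->
    raising (kron (@kid F 'I_2) (kadd i j 1)) (kron (@kid F 'I_2) (kadd i j (- 1)))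
            (@kid F C) (@kid F C)
| raise_col (i j : 'I_n) : (i < j)%N ->
    raising (@kid F A) (@kid F A)
            (kron (kadd i j 1) (@kid F 'I_2)) (kron (kadd i j (- 1)) (@kid F 'I_2))
| raise_mid :
    raising (kron (kadd 0 1 1) (@kid F 'I_n)) (kron (kadd 0 1 (- 1)) (@kid F 'I_n))
            (kron (@kid F 'I_n) (kadd 1 0 (- 1))) (kron (@kid F 'I_n) (kadd 1 0 (- - 1))).

Lemma raising_inv k k' l l' : raising k k' l l' -> kinverse k k' /\ kinverse l l'.
Proof.
have ne (i j : 'I_n) : (i < j)%N -> i != j.
  by move=> ij; apply: contraTneq ij => ->; rewrite ltnn.
by case=> [i j /ne ij|i j /ne ij|]; split; try exact: kinverse_kid;
   apply: kinverse_kron; try exact: kinverse_kid; apply: kinverse_kadd.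
Qed.

Lemma raising_low k k' l l' : raising k k' l l' -> lowering wA k /\ lowering wC l.
Proof.
have n0 (i : 'I_n) : (0 < n)%N by apply: leq_ltn_trans (ltn_ord i).
pose wa (a : 'I_2) : nat := a; pose wj (j : 'I_n) := (3 * n * j)%N.
pose wk (k : 'I_n) := (3 * k)%N; pose wc (c : 'I_2) := (1 - c)%N.
have wAE : (fun z : A => wa z.1 + wj z.2)%N =1 wA by [].
have wCE : (fun z : C => wk z.1 + wc z.2)%N =1 wC.
  by move=> z; rewrite addnC.
case=> [i j ij|i j ij|]; split; try exact: lowering_kid.
- apply: eq_lowering wAE _; apply: lowering_kron; first exact: lowering_kid.
  by apply: lowering_kadd; rewrite /wj ltn_pmul2l // muln_gt0 (n0 i).
- apply: eq_lowering wCE _; apply: lowering_kron; last exact: lowering_kid.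
  by apply: lowering_kadd; rewrite /wk ltn_pmul2l.
- apply: eq_lowering wAE _; apply: lowering_kron; last exact: lowering_kid.
  exact: lowering_kadd.
apply: eq_lowering wCE _; apply: lowering_kron; first exact: lowering_kid.
exact: lowering_kadd.
Qed.

Lemma kop_row i j t f a b k c :
  kop (kron (kron (@kid F 'I_2) (kadd i j t)) (@kid F C)) f ((a, b), (k, c)) =
  f ((a, b), (k, c)) + t * (b == i)%:R * f ((a, j), (k, c)).
Proof. by rewrite kop_kron sum_kron sum_kid sum_kadd !sum_kid. Qed.

Lemma kop_col i j t f a b k c :
  kop (kron (@kid F A) (kron (kadd i j t) (@kid F 'I_2))) f ((a, b), (k, c)) =
  f ((a, b), (k, c)) + t * (k == i)%:R * f ((a, b), (j, c)).
Proof. by rewrite kop_kron sum_kid sum_kron sum_kadd !sum_kid. Qed.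

Lemma kop_mid t u f a b k c :
  kop (kron (kron (kadd 0 1 t) (@kid F 'I_n)) (kron (@kid F 'I_n) (kadd 1 0 u))) f
    ((a, b), (k, c)) =
  f ((a, b), (k, c)) + u * (c == 1)%:R * f ((a, b), (k, 0)) +
  t * (a == 0)%:R * (f ((1, b), (k, c)) + u * (c == 1)%:R * f ((1, b), (k, 0))).
Proof.
by rewrite kop_kron sum_kron sum_kadd !sum_kid !sum_kron !sum_kid !sum_kadd.
Qed.

Lemma raising_idv k k' l l' : raising k k' l l' ->
  forall f, is_idv f -> is_idv (kop (kron k' l') f).
Proof.
case=> [i j ij|i j ij|] _ [m ->].
- exists (fun b k => m b k - (b == i)%:R * m j k).
  by apply/ffunP => -[[a b] [q c]]; rewrite kop_row !ffunE /=; ring.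
- exists (fun b k => m b k - (k == i)%:R * m b j).
  by apply/ffunP => -[[a b] [q c]]; rewrite kop_col !ffunE /=; ring.
exists m; apply/ffunP => -[[a b] [q c]]; rewrite kop_mid !ffunE /=.
by case: (ord2E a) (ord2E c) => [->|->] [->|->] /=; rewrite ?eqxx /=; ring.
Qed.

(** The three coordinates of a two by two block, from the highest to the lowest
    weight vector of the adjoint representation. *)
Definition posx j k : Y := ((0, j), (k, 1)).
Definition posh j k : Y := ((0, j), (k, 0)).
Definition posy j k : Y := ((1, j), (k, 0)).

(* Weights are read in base 3, then in base [n]. *)
Lemma wY_decode (a c : 'I_2) (j k j' k' : 'I_n) t : (t <= 2)%N ->
  (wY ((a, j'), (k', c)) == t + 3 * (n * j + k))%N =
  [&& (a + (1 - c) == t)%N, j' == j & k' == k].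
Proof.
move=> t2; rewrite /wY /wA /wC /=; apply/eqP/and3P => [e|[/eqP <- /eqP -> /eqP ->]].
  have a2 := ltn_ord a.
  have [e1 e2] : (a + (1 - c) = t /\ j' * n + k' = j * n + k)%N.
    by move: e; rewrite -mulnA [(n * j')%N]mulnC [(n * j)%N]mulnC; lia.
  have n0 : (0 < n)%N by apply: leq_ltn_trans (ltn_ord j).
  have := congr1 (divn^~ n) e2; have := congr1 (modn^~ n) e2.
  rewrite !modnMDl !divnMDl // !divn_small // !addn0 !modn_small // => ek ej.
  by split; apply/eqP => //; apply: val_inj.
lia.
Qed.

(** The chain of subspaces of 2 by 2 matrices that contain the identity and are
    invariant under upper triangular conjugation: the scalars, the upper triangular
    matrices with equal diagonal entries, the upper triangular matrices, all. *)
Definition levm (l : nat) (q : 'I_2 -> 'I_2 -> F) :=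
  [/\ (l < 3)%N -> q 1 0 = 0, (l < 2)%N -> q 0 0 = q 1 1 & (l < 1)%N -> q 0 1 = 0].

Definition levels (d : 'I_n -> 'I_n -> nat) f :=
  forall j k, levm (d j k) (fun a c => f ((a, j), (k, c))).

Section Fixed.
Variables (E : {vspace fsp F Y}).
Hypothesis E_idv : forall f, is_idv f -> f \in E.
Hypothesis E_hom : homogeneous wY E.
Hypothesis E_raise : forall k k' l l', raising k k' l l' ->
  forall w f, f \in E -> (forall z, wY z != w -> f z = 0) ->
  kop (kron k' l') f \in E.

Let comp_block t f (j k : 'I_n) : (t <= 2)%N -> f \in E ->
  [ffun y : Y => if [&& (y.1.1 + (1 - y.2.2) == t)%N, y.1.2 == j & y.2.1 == k]
             then f y else 0] \in E.
Proof.
move=> t2 /(E_hom (t + 3 * (n * j + k))%N); congr (_ \in E).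
by apply/ffunP => -[[a j'] [k' c]]; rewrite compE wY_decode // ffunE.
Qed.

Let unitvE (a : 'I_2) (j k : 'I_n) (c : 'I_2) (y : Y) :
  unitv ((a, j), (k, c)) y =
  [&& y.1.1 == a, y.1.2 == j, y.2.1 == k & y.2.2 == c]%:R.
Proof. by case: y => [[a' j'] [k' c']]; rewrite ffunE !xpair_eqE -!andbA. Qed.

Let mem_unitx f j k : f \in E -> f (posx j k) != 0 -> unitv (posx j k) \in E.
Proof.
move=> /(comp_block j k (t := 0)) -/(_ isT) fE f0.
rewrite -[unitv _]scale1r -(mulVf f0) -scalerA; apply: memvZ.
move: fE; congr (_ \in E); apply/ffunP => -[[a j'] [k' c]].
rewrite scale_fspE unitvE ffunE /=.
have [->|_] := eqVneq j' j; have [->|_] := eqVneq k' k; rewrite ?andbF ?mulr0 //.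
by case: (ord2E a) (ord2E c) => [->|->] [->|->]; rewrite /= ?mulr0 ?mulr1.
Qed.

Let mem_unity f j k : f \in E -> f (posy j k) != 0 -> unitv (posy j k) \in E.
Proof.
move=> /(comp_block j k (t := 2)) -/(_ isT) fE f0.
rewrite -[unitv _]scale1r -(mulVf f0) -scalerA; apply: memvZ.
move: fE; congr (_ \in E); apply/ffunP => -[[a j'] [k' c]].
rewrite scale_fspE unitvE ffunE /=.
have [->|_] := eqVneq j' j; have [->|_] := eqVneq k' k; rewrite ?andbF ?mulr0 //.
by case: (ord2E a) (ord2E c) => [->|->] [->|->]; rewrite /= ?mulr0 ?mulr1.
Qed.

Let id_block j k : idv (fun j' k' => ((j' == j) && (k' == k))%:R) \in E.
Proof. by apply: E_idv; eexists. Qed.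

Let memB (f g : fsp F Y) : f \in E -> g \in E -> f - g \in E.
Proof. exact: memvB. Qed.

Let memZ t (f : fsp F Y) : f \in E -> t *: f \in E.
Proof. exact: memvZ. Qed.

Let mem_unith f j k : f \in E -> f (posh j k) != f ((1, j), (k, 1)) ->
  unitv (posh j k) \in E.
Proof.
move=> /(comp_block j k (t := 1)) -/(_ isT) fE; rewrite -subr_eq0 => f0.
rewrite -[unitv _]scale1r -(mulVf f0) -scalerA; apply: memvZ.
have := memB fE (memZ (f ((1, j), (k, 1))) (id_block j k)).
congr (_ \in E); apply/ffunP => -[[a j'] [k' c]].
rewrite [RHS]scale_fspE unitvE !ffunE /= /GRing.scale /=.
have [->|_] := eqVneq j' j; have [->|_] := eqVneq k' k;
  rewrite ?andbF ?andFb ?mulr0 ?subrr ?subr0 //.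
by case: (ord2E a) (ord2E c) => [->|->] [->|->]; rewrite /= ?eqxx /=; ring.
Qed.

Let unitv_hom y0 : forall z, wY z != wY y0 -> unitv y0 z = 0.
Proof.
by move=> z; rewrite ffunE; have [->|//] := eqVneq z y0; rewrite eqxx.
Qed.

Let unit_row a (i j : 'I_n) k c : (i <= j)%N -> unitv ((a, j), (k, c)) \in E ->
  unitv ((a, i), (k, c)) \in E.
Proof.
rewrite leq_eqVlt => /orP[/eqP/val_inj -> //|ij] uE.
have := memB uE (E_raise (raise_row ij) uE (unitv_hom (y0 := _))).
congr (_ \in E); apply/ffunP => -[[a' j'] [k' c']].
rewrite ffunE [X in _ + X]ffunE kop_row !unitvE /= eqxx.
by have [->|_] := eqVneq j' i; rewrite ?andbF /=; ring.
Qed.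

Let unit_col a j (i k : 'I_n) c : (i <= k)%N -> unitv ((a, j), (k, c)) \in E ->
  unitv ((a, j), (i, c)) \in E.
Proof.
rewrite leq_eqVlt => /orP[/eqP/val_inj -> //|ik] uE.
have := memB uE (E_raise (raise_col ik) uE (unitv_hom (y0 := _))).
congr (_ \in E); apply/ffunP => -[[a' j'] [k' c']].
rewrite ffunE [X in _ + X]ffunE kop_col !unitvE /= eqxx.
by have [->|_] := eqVneq k' i; rewrite ?andbF /=; ring.
Qed.

(* Conjugation by an upper triangular transvection acts on a block as the
   exponential of the raising operator of sl_2, which moves the vector of weight 0
   to the highest one, and the lowest one to the vector of weight 0. The second
   move produces the trace-free diagonal matrix, which differs from the identity
   because the characteristic is not 2. *)
Let unit_hx j k : unitv (posh j k) \in E -> unitv (posx j k) \in E.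
Proof.
move=> uE; have := E_raise raise_mid uE (unitv_hom (y0 := _)).
move/mem_unitx; apply.
by rewrite kop_mid !unitvE /= !eqxx /= opprK !(mulr0, mulr1, addr0, add0r) oner_eq0.
Qed.

Let unit_yh j k : unitv (posy j k) \in E -> unitv (posh j k) \in E.
Proof.
move=> uE; have := E_raise raise_mid uE (unitv_hom (y0 := _)).
move/mem_unith; apply.
rewrite !kop_mid !unitvE /= !eqxx /= opprK !(mulr0, mulr1, mul0r, addr0, add0r, mul1r).
by rewrite -subr_eq0 -opprD oppr_eq0 -[1 + 1]/(2%:R).
Qed.

Definition level j k : nat :=
  ((unitv (posx j k) \in E) + (unitv (posh j k) \in E) + (unitv (posy j k) \in E))%N.

Lemma level_le3 j k : (level j k <= 3)%N.
Proof. by rewrite /level; do 3 case: (_ \in E). Qed.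

Lemma level_mono (j j' k k' : 'I_n) : (j <= j')%N -> (k <= k')%N ->
  (level j' k' <= level j k)%N.
Proof.
move=> jj kk.
have H a c : ((unitv ((a, j'), (k', c)) \in E) <= (unitv ((a, j), (k, c)) \in E))%N.
  by case: (boolP (unitv ((a, j'), (k', c)) \in E)) => [/(unit_row jj)/(unit_col kk) ->|].
by rewrite /level; apply: leq_add; [apply: leq_add|]; exact: H.
Qed.

(** Homogeneity splits an element of [E] into blocks and weights, and the level
    counts which of the resulting vectors may be nonzero. *)
Lemma levels_level f : f \in E -> levels level f.
Proof.
move=> fE j k; rewrite /level.
case: (boolP (unitv (posy j k) \in E)) => [yE|yE].
  by rewrite (unit_yh yE) (unit_hx (unit_yh yE)).
have fy : f (posy j k) = 0.
  by apply/eqP; apply: contraNT yE => /(mem_unity fE).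
case: (boolP (unitv (posh j k) \in E)) => [hE|hE].
  by rewrite (unit_hx hE).
have fh : f (posh j k) = f ((1, j), (k, 1)).
  by apply/eqP; apply: contraNT hE => /(mem_unith fE).
case: (boolP (unitv (posx j k) \in E)) => [xE|xE]; first by split.
by split=> // _; apply/eqP; apply: contraNT xE => /(mem_unitx fE).
Qed.

(** Each block contributes the identity and as many unit vectors as its level. *)
Lemma dim_levels : (n * n + \sum_(j < n) \sum_(k < n) level j k <= \dim E)%N.
Proof.
pose D (t : ('I_n * 'I_n) * 'I_4) := (t.2 <= level t.1.1 t.1.2)%N.
pose v (t : ('I_n * 'I_n) * 'I_4) : fsp F Y :=
  match val t.2 with
  | 0%N => idv (fun j' k' => ((j' == t.1.1) && (k' == t.1.2))%:R)
  | 1%N => unitv (posx t.1.1 t.1.2)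
  | 2%N => unitv (posh t.1.1 t.1.2)
  | _ => unitv (posy t.1.1 t.1.2)
  end.
have -> : (n * n + \sum_(j < n) \sum_(k < n) level j k = #|D|)%N.
  rewrite card_sumE !big_pairE /=.
  have nn : (n * n = \sum_(j < n) \sum_(k < n) 1)%N.
    by rewrite (eq_bigr (fun=> n)) => [|j _]; rewrite big_const_ord iter_addn_0 ?mul1n.
  rewrite [X in (X + _)%N]nn -big_split /=; apply: eq_bigr => j _.
  rewrite -big_split /=.
  apply: eq_bigr => k _; rewrite !big_ord_recl big_ord0 /D /= /bump /=.
  by have := level_le3 j k; case: (level j k) => [|[|[|[|]]]].
apply: (dim_ge_indep (v := v)) => [[[j k] [l l4]]|c c0 [[j k] l]].
  rewrite /D /v /=; case: l l4 => [|[|[|l]]] l4 /=; first by move=> _; apply: id_block.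
  - rewrite /level; case: (boolP (unitv (posx j k) \in E)) => // xE.
    case: (boolP (unitv (posh j k) \in E)) => [/unit_hx|hE]; first by rewrite (negPf xE).
    by case: (boolP (unitv (posy j k) \in E)) => [/unit_yh|//]; rewrite (negPf hE).
  - rewrite /level; case: (boolP (unitv (posh j k) \in E)) => // hE.
    case: (boolP (unitv (posy j k) \in E)) => [/unit_yh|_]; first by rewrite (negPf hE).
    by case: (_ \in E).
  - have -> : l = 0%N by lia.
    by rewrite /level; do 3 case: (_ \in E).
pose c' l := if D ((j, k), l) then c ((j, k), l) else 0.
have cE a b : \sum_(l < 4) c' l * v ((j, k), l) ((a, j), (k, b)) = 0.
  have /ffunP/(_ ((a, j), (k, b))) := c0; rewrite sum_fspE [RHS]ffunE; apply: etrans.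
  rewrite [RHS]big_mkcond /=.
  rewrite big_pairE /=.
  rewrite (bigD1 (j, k)) //= [X in _ + X]big1 ?addr0 => [|[j' k'] jk].
    by apply: eq_bigr => l' _; rewrite /c' scale_fspE; case: ifP; rewrite ?mul0r.
  rewrite big1 // => l' _; case: ifP => // _; rewrite scale_fspE.
  suff -> : v ((j', k'), l') ((a, j), (k, b)) = 0 by rewrite mulr0.
  have jk' : (j == j') && (k == k') = false.
    by apply/negP => /andP[/eqP jj /eqP kk]; rewrite jj kk eqxx in jk.
  rewrite /v; case: (val l') => [|[|[|?]]]; rewrite /= ?unitvE ?[idv _ _]ffunE /=;
    by case: (j == j') jk' => /= [->|_]; rewrite ?andbF ?mulr0.
move=> Dt; have -> : c ((j, k), l) = c' l by rewrite /c' Dt.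
have := (cE 0 0, cE 0 1, cE 1 0, cE 1 1).
rewrite !big_ord_recl !big_ord0 /v /= !unitvE !ffunE /= !eqxx /= /bump /=.
rewrite !(mulr0, mulr1, addr0, add0r).
move=> [[[e00 e01] e10] e11].
move: e00; rewrite e11 add0r => e00.
by case: l {Dt} => [[|[|[|[|//]]]] l4]; [rewrite -[RHS]e11 | rewrite -[RHS]e01 |
   rewrite -[RHS]e00 | rewrite -[RHS]e10]; congr (c' _); apply: val_inj.
Qed.

End Fixed.

Definition monotone_levels (d : 'I_n -> 'I_n -> nat) :=
  (forall j k, d j k <= 3)%N /\
  (forall j j' k k' : 'I_n, j <= j' -> k <= k' -> d j' k' <= d j k)%N.

Definition level_tests (d : 'I_n -> 'I_n -> nat) s := exists E,
  [/\ forall f, f \in E -> levels d f, test21 E s, test12 E s & test22 E s].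

(** Fixed spaces are spanned by identity blocks and unit vectors, so that their
    prolongations can be counted from the levels alone. *)
Theorem apolar_levels E s : apolar is_idv E s -> exists d,
  [/\ monotone_levels d, (n * n + \sum_(j < n) \sum_(k < n) d j k <= s)%N &
      level_tests d s].
Proof.
move=> /(borel_fixed is_idv_comp raising_inv raising_low raising_idv).
case=> {}E [[dE LE t1 t2 t3] hE st].
exists (level E); split.
- by split=> *; [apply: level_le3 | apply: level_mono].
- by apply: leq_trans dE; apply: dim_levels.
exists E; split=> // f fE; exact: levels_level.
Qed.

End Levels.

(** * Counting the prolongations *)

(** The number of prolongations in a family of four blocks, or of two blocks of
    the same column, is bounded by a set of coordinates on which a prolongation
    cannot vanish without being zero. In [det21 l l'], a vector [p a b c] has its
    slices at fixed [a] in level [l'] and its slices at fixed [b] in level [l]; in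
    [det20] both levels are [l] and [p] is symmetric in [a] and [b]. In [det22] the
    coordinates of [p a b c e] are paired in four ways, with level [w] for [(a, c)],
    [x] for [(a, e)], [y] for [(b, c)] and [z] for [(b, e)]; the flags [ej] and [ek]
    say that [p] is symmetric in [a, b] and in [c, e]. *)
Definition det21 (l l' a b c : nat) : bool :=
  match l, l' with
  | 3, 3 => true
  | 3, 2 => (b <= c)
  | 3, 1 => (b == 0)
  | 3, 0 => (b == 0) && (c == 0)
  | 2, 2 => (c == 1) || (a == 0) && (b == 0)
  | 2, 1 => (b == 0) && ((c == 1) || (a == 0))
  | 2, 0 => [&& a == 0, b == 0 & c == 0]
  | 1, 1 => (a == 0) && (b == 0)
  | _, _ => false
  end%N.

Definition det20 (l a b c : nat) : bool :=
  match l with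
  | 3 => (a <= b)
  | 2 => (a <= b <= c)
  | 1 => (a == 0) && (b == 0)
  | _ => false
  end%N.

Definition det22 (w x y z : nat) (ej ek : bool) (a b c e : nat) : bool :=
  if z == 0 then
    [&& y != 0, x != 0, b == 0, e == 0, (y == 3) || (c == 1) & (x == 3) || (a == 0)]
  else
    [&& (z == 3) || (b <= e), (y == 3) || (b <= c), (x == 3) || (a <= e),
        (w == 3) || (a <= c), ej ==> (a <= b) & ek ==> (c <= e)]%N.

Definition bits : seq nat := [:: 0; 1]%N.

Definition num21 l l' : nat :=
  \sum_(a <- bits) \sum_(b <- bits) \sum_(c <- bits) det21 l l' a b c.
Definition num20 l : nat :=
  \sum_(a <- bits) \sum_(b <- bits) \sum_(c <- bits) det20 l a b c.
Definition num22 w x y z ej ek : nat :=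
  \sum_(a <- bits) \sum_(b <- bits) \sum_(c <- bits) \sum_(e <- bits)
    det22 w x y z ej ek a b c e.

Lemma sum_bits (G : nat -> nat) : (\sum_(a < 2) G a = \sum_(a <- bits) G a)%N.
Proof. by rewrite !big_ord_recl big_ord0 !big_cons big_nil. Qed.

Section Local.
Variable F : fieldType.

(* For each of the ten pairs of levels, the hypotheses are vanishings of and
   equalities between the eight coordinates: congruence closure decides. *)
Lemma det21P (l l' : nat) (p : 'I_2 -> 'I_2 -> 'I_2 -> F) :
  (l <= 3)%N -> (l' <= l)%N ->
  (forall a, levm l' (p a)) -> (forall b, levm l (fun a c => p a b c)) ->
  (forall a b c : 'I_2, det21 l l' a b c -> p a b c = 0) ->
  forall a b c, p a b c = 0.
Proof.
move=> l3 ll' pl' pl p0 a b c.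
have [u1 u2 u3] := pl' 0; have [v1 v2 v3] := pl' 1.
have [w1 w2 w3] := pl 0; have [x1 x2 x3] := pl 1.
have z000 := p0 0 0 0; have z001 := p0 0 0 1; have z010 := p0 0 1 0.
have z011 := p0 0 1 1; have z100 := p0 1 0 0; have z101 := p0 1 0 1.
have z110 := p0 1 1 0; have z111 := p0 1 1 1.
case: (ord2E a) (ord2E b) (ord2E c) => [->|->] [->|->] [->|->];
case: l l3 ll' pl w1 w2 w3 x1 x2 x3 z000 z001 z010 z011 z100 z101 z110 z111 p0 =>
  [|[|[|[|//]]]] _; case: l' pl' u1 u2 u3 v1 v2 v3 => [|[|[|[|//]]]] //= _;
  intuition congruence.
Qed.

Lemma levm_tri l (q : 'I_2 -> 'I_2 -> F) (b e : 'I_2) :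
  (l <= 3)%N -> levm l q -> ~~ ((l == 3) || (b <= e)%N) -> q b e = 0.
Proof.
move=> l3 [q10 _ _]; rewrite negb_or => /andP[l3'].
by case: (ord2E b) (ord2E e) => [->|->] [->|->] // _; apply: q10; lia.
Qed.

(** Each level below 3 kills the coordinates where the corresponding pair is
    decreasing, and symmetry sorts [(a, b)] and [(c, e)]. If [z = 0], the blocks in
    [(b, e)] are moreover scalar: there is one unknown for each [(a, c)], which
    vanishes if a second pair has level 0. *)
Lemma det22P (w x y z : nat) (ej ek : bool)
    (p : 'I_2 -> 'I_2 -> 'I_2 -> 'I_2 -> F) :
  [&& w <= 3, x <= 3, y <= 3 & z <= 3]%N ->
  (ej -> w = y /\ x = z) -> (ek -> w = x /\ y = z) ->
  (forall a c, levm z (fun b e => p a b c e)) ->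
  (forall a e, levm y (fun b c => p a b c e)) ->
  (forall b c, levm x (fun a e => p a b c e)) ->
  (forall b e, levm w (fun a c => p a b c e)) ->
  (ej -> forall a b c e, p a b c e = p b a c e) ->
  (ek -> forall a b c e, p a b c e = p a b e c) ->
  (forall a b c e : 'I_2, det22 w x y z ej ek a b c e -> p a b c e = 0) ->
  forall a b c e, p a b c e = 0.
Proof.
case/and4P=> w3 x3 y3 z3 ejE ekE pz py px pw sj sk p0.
have [z0|z0] := eqVneq z 0%N.
  have pbe a b c e : b != e -> p a b c e = 0.
    have [q10 _ q01] := pz a c; move: q10 q01; rewrite z0 => q10 q01.
    by case: (ord2E b) (ord2E e) => [->|->] [->|->]; rewrite ?eqxx // => _;
       first [exact: q01 | exact: q10].
  have pd a c : p a 0 c 0 = p a 1 c 1.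
    by have [_ q _] := pz a c; apply: q; rewrite z0.
  suff p00 a c : p a 0 c 0 = 0.
    move=> a b c e; have [<-|be] := eqVneq b e; last exact: pbe.
    by case: (ord2E b) => ->; rewrite -?pd.
  have [y0|y0] := eqVneq y 0%N.
    have [q10 qd q01] := py a (if c == 0 then 1 else 0); move: q10 qd q01; rewrite y0.
    case: (ord2E c) => -> /=; rewrite ?eqxx /= => q10 qd q01.
      by rewrite pd; apply: q10.
    by apply: q01.
  have [x0|x0] := eqVneq x 0%N.
    have [q10 qd q01] := px (if a == 0 then 1 else 0) c; move: q10 qd q01; rewrite x0.
    case: (ord2E a) => -> /=; rewrite ?eqxx /= => q10 qd q01.
      by rewrite pd; apply: q01.
    by apply: q10.
  have [yc|yc] := boolP ((y == 3) || (c == 1 :> nat)); last first.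
    rewrite pd; apply: (levm_tri y3 (py a 1)); move: yc; rewrite !negb_or => /andP[-> /=].
    by case: (ord2E c) => ->.
  have [xa|xa] := boolP ((x == 3) || (a == 0 :> nat)); last first.
    apply: (levm_tri x3 (px 0 c)); move: xa; rewrite !negb_or => /andP[-> /=].
    by case: (ord2E a) => ->.
  by apply: p0; rewrite /det22 z0 y0 x0 yc xa.
have srt (a b c e : 'I_2) : (ej ==> (a <= b)%N) -> (ek ==> (c <= e)%N) -> p a b c e = 0.
  move=> ha hc.
  have [hz|hz] := boolP ((z == 3) || (b <= e)%N); last exact: (levm_tri z3 (pz a c)).
  have [hy|hy] := boolP ((y == 3) || (b <= c)%N); last exact: (levm_tri y3 (py a e)).
  have [hx|hx] := boolP ((x == 3) || (a <= e)%N); last exact: (levm_tri x3 (px b c)).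
  have [hw|hw] := boolP ((w == 3) || (a <= c)%N); last exact: (levm_tri w3 (pw b e)).
  by apply: p0; rewrite /det22 (negPf z0) hz hy hx hw ha hc.
have srt' (a b c e : 'I_2) : (ek ==> (c <= e)%N) -> p a b c e = 0.
  move=> hc; have [ha|] := boolP (ej ==> (a <= b)%N); first exact: srt.
  rewrite negb_imply -ltnNge => /andP[j ba]; rewrite sj //.
  by apply: srt => //; rewrite (ltnW ba) implybT.
move=> a b c e; have [hc|] := boolP (ek ==> (c <= e)%N); first exact: srt'.
rewrite negb_imply -ltnNge => /andP[k ec]; rewrite sk //.
by apply: srt'; rewrite (ltnW ec) implybT.
Qed.

Lemma det20P l (p : 'I_2 -> 'I_2 -> 'I_2 -> F) :
  (l <= 3)%N -> (forall a, levm l (p a)) -> (forall a b c, p a b c = p b a c) ->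
  (forall a b c : 'I_2, det20 l a b c -> p a b c = 0) ->
  forall a b c, p a b c = 0.
Proof.
move=> l3 pl sy p0; apply: (det21P l3 (leqnn l) pl).
  move=> b; have [q1 q2 q3] := pl b; split=> h; rewrite ![p _ b _]sy; auto.
move=> a b c.
case: l l3 pl p0 => [|[|[|[|//]]]] //= _ pl p0.
- exact: p0.
- case: (ord2E a) (ord2E b) (ord2E c) => [->|->] [->|->] [->|->] //= _;
    try exact: p0; rewrite sy; exact: p0.
case: (leqP a b) => [ab|/ltnW ba] _; first exact: p0.
by rewrite sy; apply: p0.
Qed.

End Local.

Lemma sum_AY n (G : ('I_2 * 'I_n) * (('I_2 * 'I_n) * ('I_n * 'I_2)) -> nat) :
  (\sum_z G z = \sum_j \sum_j' \sum_k \sum_a \sum_b \sum_c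
     G ((a, j), ((b, j'), (k, c))))%N.
Proof.
transitivity (\sum_a \sum_j \sum_b \sum_j' \sum_k \sum_c
     G ((a, j), ((b, j'), (k, c))))%N.
  rewrite !big_pairE; apply: eq_bigr => a _; apply: eq_bigr => j _.
  by rewrite !big_pairE; apply: eq_bigr => b _; apply: eq_bigr => j' _; rewrite big_pairE.
rewrite exchange_big; apply: eq_bigr => j _.
under eq_bigr => a _ do rewrite exchange_big.
rewrite exchange_big; apply: eq_bigr => j' _.
under eq_bigr => a _ do rewrite exchange_big.
by rewrite exchange_big.
Qed.

Lemma sum_YY n (G : (('I_2 * 'I_n) * ('I_n * 'I_2)) * (('I_2 * 'I_n) * ('I_n * 'I_2)) -> nat) :
  (\sum_z G z = \sum_j \sum_j' \sum_k \sum_k' \sum_a \sum_b \sum_c \sum_e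
     G (((a, j), (k, c)), ((b, j'), (k', e))))%N.
Proof.
transitivity (\sum_a \sum_j \sum_k \sum_c \sum_b \sum_j' \sum_k' \sum_e
     G (((a, j), (k, c)), ((b, j'), (k', e))))%N.
  rewrite !big_pairE; apply: eq_bigr => a _; apply: eq_bigr => j _.
  rewrite !big_pairE; apply: eq_bigr => k _; apply: eq_bigr => c _.
  by rewrite !big_pairE; apply: eq_bigr => b _; apply: eq_bigr => j' _; rewrite big_pairE.
rewrite exchange_big; apply: eq_bigr => j _.
transitivity (\sum_a \sum_j' \sum_k \sum_c \sum_b \sum_k' \sum_e
     G (((a, j), (k, c)), ((b, j'), (k', e))))%N.
  apply: eq_bigr => a _; rewrite [RHS]exchange_big; apply: eq_bigr => k _.
  by rewrite [RHS]exchange_big; apply: eq_bigr => c _; rewrite exchange_big.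
rewrite exchange_big; apply: eq_bigr => j' _.
rewrite exchange_big; apply: eq_bigr => k _.
transitivity (\sum_a \sum_k' \sum_c \sum_b \sum_e
     G (((a, j), (k, c)), ((b, j'), (k', e))))%N.
  apply: eq_bigr => a _; rewrite [RHS]exchange_big; apply: eq_bigr => c _.
  by rewrite exchange_big.
rewrite exchange_big; apply: eq_bigr => k' _; apply: eq_bigr => a _.
by rewrite exchange_big.
Qed.

Section Counting.
Variables (F : fieldType) (n : nat).
Notation A := ('I_2 * 'I_n)%type.
Notation C := ('I_n * 'I_2)%type.
Notation Y := (A * C)%type.
Variables (d : 'I_n -> 'I_n -> nat) (E : {vspace fsp F Y}) (s : nat).
Hypothesis d_mono : monotone_levels d.
Hypothesis E_lev : forall f, f \in E -> levels d f.

(** A prolongation is determined by its values at pairs of rows [j <= j'], by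
    symmetry, and for each pair by a determining set of coordinates. *)
Lemma count21 : test21 E s ->
  (s <= \sum_(j < n) \sum_(j' < n) \sum_(k < n)
     if j < j' then num21 (d j k) (d j' k) else
     if j == j' then num20 (d j k) else 0)%N.
Proof.
move=> [K [sK KE]]; apply: leq_trans sK _; have [d3 dm] := d_mono.
pose D (z : A * Y) : bool :=
  let: ((a, j), ((b, j'), (k, c))) := z in
  if (j < j')%N then det21 (d j k) (d j' k) a b c else
  (j == j') && det20 (d j k) a b c.
apply: (@leq_trans #|D|).
  apply: dim_le_determining => Q QK Q0; have [sy sl] := KE Q QK.
  pose p j j' k a b c := Q ((a, j), ((b, j'), (k, c))).
  have psy j j' k a b c : p j j' k a b c = p j' j k b a c.
    by rewrite /p -(sy _ erefl).
  have plev j j' k a : levm (d j' k) (p j j' k a).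
    by have := E_lev (sl (a, j)) j' k; rewrite /levm !ffunE.
  have plev' j j' k b : levm (d j k) (fun a c => p j j' k a b c).
    by have [q1 q2 q3] := plev j' j k b; split=> h; rewrite ![p j j' k _ b _]psy; auto.
  have plt (j j' : 'I_n) k a b c : (j < j')%N -> p j j' k a b c = 0.
    move=> jj; apply: (det21P (d3 j k) (dm _ _ _ _ (ltnW jj) (leqnn k)) (plev j j' k)
      (plev' j j' k)) => {}a {}b {}c h.
    by apply: Q0; rewrite /D jj.
  apply/ffunP => -[[a j] [[b j'] [k c]]]; rewrite [RHS]ffunE -/(p j j' k a b c).
  case: (ltngtP j j') => [|jj|/val_inj <-]; first exact: plt.
    by rewrite psy; apply: plt.
  apply: (det20P (d3 j k) (plev j j k) (fun a b c => psy j j k a b c)) => {}a {}b {}c h.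
  by apply: Q0; rewrite /D ltnn eqxx.
rewrite card_sumE sum_AY; apply: leq_sum => j _; apply: leq_sum => j' _.
apply: leq_sum => k _; rewrite /D; case: ifP => [_|_].
  rewrite /num21 -sum_bits; apply: leq_sum => a _.
  by rewrite -sum_bits; apply: leq_sum => b _; rewrite -sum_bits.
case: eqP => _; last by do 3 (apply: big1_eq || rewrite big1 // => ? _).
rewrite /num20 -sum_bits; apply: leq_sum => a _.
by rewrite -sum_bits; apply: leq_sum => b _; rewrite -sum_bits.
Qed.

Lemma count22 : test22 E s ->
  (s <= \sum_(j < n) \sum_(j' < n) \sum_(k < n) \sum_(k' < n)
     if (j <= j') && (k <= k') then
       num22 (d j k) (d j k') (d j' k) (d j' k') (j == j') (k == k')
     else 0)%N.
Proof.
move=> [K [sK KE]]; apply: leq_trans sK _; have [d3 dm] := d_mono.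
pose D (z : Y * Y) : bool :=
  let: (((a, j), (k, c)), ((b, j'), (k', e))) := z in
  [&& (j <= j')%N, (k <= k')%N &
    det22 (d j k) (d j k') (d j' k) (d j' k') (j == j') (k == k') a b c e].
apply: (@leq_trans #|D|).
  apply: dim_le_determining => Q QK Q0; have [sy sl] := KE Q QK.
  pose p j j' k k' a b c e := Q (((a, j), (k, c)), ((b, j'), (k', e))).
  have syA j j' k k' a b c e : p j j' k k' a b c e = p j' j k k' b a c e.
    by rewrite /p -(sy _ (or_introl erefl)).
  have syC j j' k k' a b c e : p j j' k k' a b c e = p j j' k' k a b e c.
    by rewrite /p -(sy _ (or_intror erefl)).
  have lz j j' k k' a c : levm (d j' k') (fun b e => p j j' k k' a b c e).
    by have := E_lev (sl ((a, j), (k, c))) j' k'; rewrite /levm !ffunE.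
  have ly j j' k k' a e : levm (d j' k) (fun b c => p j j' k k' a b c e).
    by have [q1 q2 q3] := lz j j' k' k a e; split=> h; rewrite ![p _ _ k k' _ _ _ _]syC; auto.
  have lx j j' k k' b c : levm (d j k') (fun a e => p j j' k k' a b c e).
    by have [q1 q2 q3] := lz j' j k k' b c; split=> h; rewrite ![p j j' _ _ _ _ _ _]syA; auto.
  have lw j j' k k' b e : levm (d j k) (fun a c => p j j' k k' a b c e).
    by have [q1 q2 q3] := lx j j' k' k b e; split=> h; rewrite ![p _ _ k k' _ _ _ _]syC; auto.
  have srt (j j' k k' : 'I_n) a b c e : (j <= j')%N -> (k <= k')%N -> p j j' k k' a b c e = 0.
    move=> jj kk.
    apply: (@det22P _ (d j k) (d j k') (d j' k) (d j' k') (j == j') (k == k')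
             (p j j' k k')).
    - by rewrite !d3.
    - by move=> /eqP ->.
    - by move=> /eqP ->.
    - exact: lz.
    - exact: ly.
    - exact: lx.
    - exact: lw.
    - by move=> /eqP -> *; exact: syA.
    - by move=> /eqP -> *; exact: syC.
    by move=> {}a {}b {}c {}e h; apply: Q0; rewrite /D jj kk h.
  apply/ffunP => -[[[a j] [k c]] [[b j'] [k' e]]]; rewrite [RHS]ffunE.
  rewrite -/(p j j' k k' a b c e).
  case: (leqP j j') => [jj|/ltnW jj]; case: (leqP k k') => [kk|/ltnW kk].
  - exact: srt.
  - by rewrite syC; apply: srt.
  - by rewrite syA; apply: srt.
  by rewrite syA syC; apply: srt.
rewrite card_sumE sum_YY; apply: leq_sum => j _; apply: leq_sum => j' _.
apply: leq_sum => k _; apply: leq_sum => k' _; rewrite /D.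
case: (j <= j')%N; case: (k <= k')%N => /=;
  try by do 4 (rewrite big1 // => ? _).
rewrite /num22 -sum_bits; apply: leq_sum => a _.
rewrite -sum_bits; apply: leq_sum => b _.
by rewrite -sum_bits; apply: leq_sum => c _; rewrite -sum_bits.
Qed.

End Counting.

(** * Transposition *)

(** Reversing the order of the factors preserves the form of the tensor, exchanges
    the tests on [A] and [C], and transposes the diagram of levels; the two basis
    vectors inside a block are exchanged to keep the blocks upper triangular. *)
Section Transposition.
Variables (F : fieldType) (n : nat).
Notation A := ('I_2 * 'I_n)%type.
Notation C := ('I_n * 'I_2)%type.
Notation Y := (A * C)%type.

Definition toC (x : A) : C := (x.2, rev_ord x.1).
Definition toA (x : C) : A := (rev_ord x.2, x.1).
Definition toY (y : Y) : Y := (toA y.2, toC y.1).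

Lemma toCK : cancel toC toA.
Proof. by case=> a j; rewrite /toA /toC /= rev_ordK. Qed.
Lemma toAK : cancel toA toC.
Proof. by case=> j a; rewrite /toA /toC /= rev_ordK. Qed.
Lemma toYK : involutive toY.
Proof. by case=> x y; rewrite /toY /= toAK toCK. Qed.

Definition transp : 'End(fsp F Y) := linfun (pull (fun=> 1) toY).

Lemma transpE f y : transp f y = f (toY y).
Proof. by rewrite lfunE ffunE mul1r. Qed.

Lemma test_transp (X X' : finType) (Sy : (X * Y -> X * Y) -> Prop)
    (Sy' : (X' * Y -> X' * Y) -> Prop) (psi : X' -> X) (psi' : X -> X') E s :
  cancel psi' psi ->
  (forall p, Sy' p -> exists2 q, Sy q & forall z,
     (psi (p z).1, toY (p z).2) = q (psi z.1, toY z.2)) ->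
  test Sy E s -> test Sy' (transp @: E) s.
Proof.
move=> psiK sy [K [sK KE]].
pose T := linfun (pull (fun=> 1) (fun z : X' * Y => (psi z.1, toY z.2)) :
   fsp F (X * Y)%type -> fsp F (X' * Y)%type).
have TE Q z : T Q z = Q (psi z.1, toY z.2) by rewrite lfunE ffunE mul1r.
exists (T @: K)%VS; split.
  rewrite limg_dim_eq //; apply/eqP; rewrite -subv0; apply/subvP => Q.
  move=> /memv_capP[_]; rewrite memv_ker memv0 => /eqP/ffunP Q0.
  apply/eqP/ffunP => -[x y]; have := Q0 (psi' x, toY y).
  by rewrite TE /= psiK toYK !ffunE.
move=> _ /memv_imgP[Q QK ->]; have [syQ sl] := KE Q QK; split=> [p /sy[q qS pq] z|x].
  by rewrite !TE pq syQ.
have -> : slice x (T Q) = transp (slice (psi x) Q).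
  by apply/ffunP => y; rewrite transpE !ffunE TE.
by apply: memv_img.
Qed.

Lemma level_tests_transp (d : 'I_n -> 'I_n -> nat) s :
  level_tests F d s -> level_tests F (fun j k => d k j) s.
Proof.
move=> [E [lE t1 t2 t3]]; exists (transp @: E)%VS; split.
- move=> _ /memv_imgP[f fE ->] j k; have [q1 q2 q3] := lE f fE k j.
  have r0 : rev_ord (0 : 'I_2) = 1 by apply: val_inj.
  have r1 : rev_ord (1 : 'I_2) = 0 by apply: val_inj.
  by split=> h; rewrite !transpE /toY /toA /toC /= ?r0 ?r1; [apply: q1 | rewrite q2 | apply: q3].
- apply: (test_transp (psi := toC) (psi' := toA)) t2; first exact: toAK.
  by move=> _ <-; exists (@swapC _ _) => // -[x [x' c]]; rewrite /swapC /swapA /toY /= toAK.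
- apply: (test_transp (psi := toA) (psi' := toC)) t1; first exact: toCK.
  by move=> _ <-; exists (@swapA _ _) => // -[x [x' c]]; rewrite /swapC /swapA /toY /= toCK.
apply: (test_transp (psi := toY) (psi' := toY)) t3; first exact: toYK.
move=> _ [] ->; [exists (@swapYC _ _); first by right | exists (@swapYA _ _); first by left].
  by move=> [[x c] [x' c']].
by move=> [[x c] [x' c']].
Qed.

End Transposition.

(** * Limits along an ultrafilter *)

(** Limits along an ultrafilter exist for all bounded sequences at once, so that
    no subsequence is ever extracted. *)
Section UltraLimits.
Variables (R : realType) (U : set_system nat).
Hypothesis UU : UltraFilter U.
Local Notation C := R[i].
Local Notation Re := (@complex.Re R).
Local Notation Im := (@complex.Im R).

Definition rlim (u : nat -> R) (l : R) := (u m @[m --> U] --> l)%classic.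

(* The topology of [R[i]] is only visible through its structure of [numFieldType],
   and compactness is available for [R]: complex limits are taken by real and
   imaginary parts. *)
Definition clim (u : nat -> C) (l : C) :=
  rlim (fun m => Re (u m)) (Re l) /\ rlim (fun m => Im (u m)) (Im l).

Let PU : ProperFilter U := ultra_proper.

Lemma rlim_exists (u : nat -> R) : (forall m, `|u m| <= 1) -> exists l, rlim u l.
Proof.
move=> u1.
have uA : U (u @^-1` `[-1, 1])%classic.
  by apply: filterE => m /=; rewrite in_itv /= -ler_norml.
have [l [_ cl]] := @segment_compact R (-1) 1 (u @ U)%classic (fmap_proper_filter u PU) uA.
exists l => N Nl.
have [//|UN] := in_ultra_setVsetC (u @^-1` N)%classic UU.
by have [x [xN]] := cl (~` N)%classic N UN Nl.
Qed.

Lemma clim_unique u l l' : clim u l -> clim u l' -> l = l'.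
Proof.
case: l l' => [a b] [c e] [/= r1 i1] [/= r2 i2].
by rewrite (cvg_unique (@norm_hausdorff _ R) r1 r2) (cvg_unique (@norm_hausdorff _ R) i1 i2).
Qed.

Lemma clim_cst l : clim (fun=> l) l.
Proof. by split; apply: cvg_cst. Qed.

Lemma ReDE (x y : C) : Re (x + y) = Re x + Re y.
Proof. by case: x y => [a b] [c e]. Qed.
Lemma ImDE (x y : C) : Im (x + y) = Im x + Im y.
Proof. by case: x y => [a b] [c e]. Qed.
Lemma ReME (x y : C) : Re (x * y) = Re x * Re y - Im x * Im y.
Proof. by case: x y => [a b] [c e]. Qed.
Lemma ImME (x y : C) : Im (x * y) = Re x * Im y + Im x * Re y.
Proof. by case: x y => [a b] [c e]. Qed.

Lemma climD u v l m : clim u l -> clim v m -> clim (fun i => u i + v i) (l + m).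
Proof.
move=> [r1 i1] [r2 i2]; split; rewrite ?ReDE ?ImDE.
  by under eq_fun do rewrite ReDE; exact: cvgD r1 r2.
by under eq_fun do rewrite ImDE; exact: cvgD i1 i2.
Qed.

Lemma climM u v l m : clim u l -> clim v m -> clim (fun i => u i * v i) (l * m).
Proof.
move=> [r1 i1] [r2 i2]; split; rewrite ?ReME ?ImME.
  by under eq_fun do rewrite ReME; exact: cvgB (cvgM r1 r2) (cvgM i1 i2).
by under eq_fun do rewrite ImME; exact: cvgD (cvgM r1 i2) (cvgM i1 r2).
Qed.

Lemma eq_clim u v l : U [set m | u m = v m]%classic -> clim u l -> clim v l.
Proof.
move=> uv [r1 i1]; split.
  apply: cvg_trans r1; apply: near_eq_cvg.
  by apply: (filterS _ uv) => t /= ->.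
apply: cvg_trans i1; apply: near_eq_cvg.
by apply: (filterS _ uv) => t /= ->.
Qed.

Lemma clim_exists (u : nat -> C) :
  (forall m, Re (u m) ^+ 2 + Im (u m) ^+ 2 <= 1) -> exists l, clim u l.
Proof.
move=> u1.
have [m|a ra] := @rlim_exists (fun m => Re (u m)).
  by rewrite -(@ler_pXn2r _ 2) ?nnegrE // expr1n -normrX ger0_norm ?sqr_ge0 //;
     apply: le_trans (u1 m); rewrite lerDl sqr_ge0.
have [m|b ib] := @rlim_exists (fun m => Im (u m)).
  by rewrite -(@ler_pXn2r _ 2) ?nnegrE // expr1n -normrX ger0_norm ?sqr_ge0 //;
     apply: le_trans (u1 m); rewrite lerDr sqr_ge0.
by exists (Complex a b).
Qed.

(** This makes the discrete data of a sequence, such as a dimension, constant. *)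
Lemma ultra_fin (T : finType) (f : nat -> T) : exists t, U [set m | f m = t]%classic.
Proof.
apply: contrapT => no.
have H (s : seq T) : U [set m | f m \notin s]%classic.
  elim: s => [|t s IHs]; first by apply: filterE.
  have [Ut|Ut] := in_ultra_setVsetC [set m | f m = t]%classic UU.
    by case: no; exists t.
  by apply: filterS2 Ut IHs => m /= mt ms; rewrite inE negb_or ms andbT; apply/eqP.
have /filter_ex[m] := H (enum T).
by rewrite /= mem_enum.
Qed.

(** ** Limits of subspaces *)

Variable Y : finType.
Implicit Types (V : nat -> {vspace fsp C Y}).

Definition flim (u : nat -> fsp C Y) (f : fsp C Y) :=
  forall y, clim (fun m => u m y) (f y).

Definition limit_space V (W : {vspace fsp C Y}) :=
  (forall u f, U [set m | u m \in V m]%classic -> flim u f -> f \in W) /\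
  (forall f, f \in W -> exists u,
     U [set m | u m \in V m]%classic /\ flim u f).

Lemma normalised_vector (V : {vspace fsp C Y}) : \dim V != 0%N ->
  exists fy : fsp C Y * Y, [/\ fy.1 \in V, fy.1 fy.2 = 1 &
    forall y, Re (fy.1 y) ^+ 2 + Im (fy.1 y) ^+ 2 <= 1].
Proof.
rewrite dimv_eq0 => V0.
set f := vpick V; have fV : f \in V by apply: memv_pick.
have f0 : f != 0 by rewrite vpick0.
pose N (z : C) := Re z ^+ 2 + Im z ^+ 2.
have NM z w : N (z * w) = N z * N w by rewrite /N ReME ImME; ring.
have [y0 fy0] : exists y, f y != 0.
  apply: contrapT => no; move/eqP: f0; apply; apply/ffunP => y; rewrite ffunE.
  by apply/eqP; apply: contrapT => fy; apply: no; exists y; apply/negP.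
case: (@arg_maxP _ _ _ y0 xpredT (fun y => N (f y)) isT) => y1 _ max.
have N0 z : N z = 0 -> z = 0.
  move=> /eqP; rewrite paddr_eq0 ?sqr_ge0 // !sqrf_eq0 => /andP[/eqP a /eqP b].
  by case: z a b => a b /= -> ->.
have Nge z : 0 <= N z by rewrite addr_ge0 ?sqr_ge0.
have fy1 : f y1 != 0.
  apply: contraNneq fy0 => f10; apply/eqP/N0/eqP; rewrite eq_le Nge andbT.
  by apply: le_trans (max y0 isT) _; rewrite f10 /N /= expr0n /= addr0.
exists ((f y1)^-1 *: f, y1); split=> /=.
- exact: memvZ.
- by rewrite scale_fspE mulVf.
move=> y; rewrite scale_fspE -/(N _) NM.
have N1 : N (f y1)^-1 * N (f y1) = 1 by rewrite -NM mulVf // /N /= expr1n expr0n addr0.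
by rewrite -N1; apply: ler_wpM2l; [exact: Nge | exact: max].
Qed.

Lemma flim_scale (a : nat -> C) (u : nat -> fsp C Y) l f :
  clim a l -> flim u f -> flim (fun m => a m *: u m) (l *: f).
Proof.
move=> al uf y; rewrite [(l *: f) y]scale_fspE.
by apply: eq_clim (climM al (uf y)); apply: filterE => m /=; rewrite scale_fspE.
Qed.

Lemma flimD (u v : nat -> fsp C Y) f g :
  flim u f -> flim v g -> flim (fun m => u m + v m) (f + g).
Proof.
move=> uf vg y; rewrite [(f + g) y]ffunE.
by apply: eq_clim (climD (uf y) (vg y)); apply: filterE => m /=; rewrite ffunE.
Qed.

Lemma flim_exists (u : nat -> fsp C Y) :
  (forall m y, Re (u m y) ^+ 2 + Im (u m y) ^+ 2 <= 1) -> exists f, flim u f.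
Proof.
move=> u1; pose f y := projT1 (cid (clim_exists (fun m => u1 m y))).
exists [ffun y => f y] => y; rewrite ffunE.
exact: projT2 (cid (clim_exists (fun m => u1 m y))).
Qed.

Definition ev (y : Y) : 'Hom(fsp C Y, fsp C unit) := linfun (pull (fun=> 1) (fun=> y)).

Lemma memv_ev y f : (f \in lker (ev y)) = (f y == 0).
Proof.
rewrite memv_ker; apply/eqP/eqP => [/ffunP/(_ tt)|f0]; last first.
  by apply/ffunP => t; rewrite lfunE !ffunE f0 mulr0.
by rewrite lfunE !ffunE mul1r.
Qed.

Lemma dim_cap_ev (V : {vspace fsp C Y}) f y : f \in V -> f y = 1 ->
  \dim V = (\dim (V :&: lker (ev y))).+1.
Proof.
move=> fV fy.
rewrite -(limg_ker_dim (ev y) V) -addn1; congr (_ + _)%N.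
have evE g t : ev y g t = g y by rewrite lfunE ffunE mul1r.
have -> : (ev y @: V = <[ev y f]>)%VS.
  apply/eqP; rewrite eqEsubv -memvE memv_img // andbT.
  apply/subvP => _ /memv_imgP[g gV ->]; apply/vlineP; exists (g y).
  by apply/ffunP => t; rewrite scale_fspE !evE fy mulr1.
rewrite dim_vline; case: eqP => // /ffunP/(_ tt); rewrite evE fy ffunE.
by move/eqP; rewrite oner_eq0.
Qed.

(** Compactness of the Grassmannian. A nonzero subspace has a vector whose
    largest coordinate is 1; its limit splits off a line, and the vectors
    vanishing at that coordinate form a subspace of smaller dimension. *)
Lemma limit_space_exists s V : U [set m | \dim (V m) = s]%classic ->
  exists2 W, \dim W = s & limit_space V W.
Proof.
elim: s V => [|s IHs] V dV.
  exists 0%VS; first exact: dimv0.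
  split=> [u f uV uf|f]; last first.
    rewrite memv0 => /eqP ->; exists (fun=> 0); split; last first.
      move=> y; rewrite ffunE; apply: eq_clim (clim_cst 0); apply: filterE => m; by rewrite /= ?ffunE.
    by apply: filterE => m /=; apply: mem0v.
  rewrite memv0; apply/eqP/ffunP => y; rewrite ffunE.
  apply: clim_unique (uf y) _; apply: eq_clim (clim_cst 0).
  apply: filterS2 dV uV => m /= /eqP; rewrite dimv_eq0 => /eqP ->.
  by rewrite memv0 => /eqP ->; rewrite ffunE.
have [y0] : exists y0 : Y, True.
  have /filter_ex[m /= dm] := dV.
  by have [|[f y] _] := @normalised_vector (V m); rewrite ?dm //; exists y.
move=> _.
pose P m (fy : fsp C Y * Y) := [/\ fy.1 \in V m, fy.1 fy.2 = 1 &
    forall y, Re (fy.1 y) ^+ 2 + Im (fy.1 y) ^+ 2 <= 1].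
have [fy fyP] : exists fy : nat -> fsp C Y * Y, forall m,
    (\dim (V m) = s.+1 -> P m (fy m)) /\
    (forall y, Re ((fy m).1 y) ^+ 2 + Im ((fy m).1 y) ^+ 2 <= 1).
  suff H m : exists fy : fsp C Y * Y, (\dim (V m) = s.+1 -> P m fy) /\
      (forall y, Re (fy.1 y) ^+ 2 + Im (fy.1 y) ^+ 2 <= 1).
    by exists (fun m => projT1 (cid (H m))) => m; exact: projT2 (cid (H m)).
  have [dm|dm] := pselect (\dim (V m) = s.+1).
    have [|p pP] := @normalised_vector (V m); first by rewrite dm.
    by exists p; split=> //; case: pP.
  by exists (0, y0); split=> // y /=; rewrite ffunE /= expr0n addr0 ler01.
have [y yU] := ultra_fin (fun m => (fy m).2).
have [g fg] := flim_exists (fun m => (fyP m).2).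
pose f m := (fy m).1.
have fP : U [set m | \dim (V m) = s.+1 /\ f m \in V m /\ f m y = 1]%classic.
  apply: filterS2 dV yU => m /= dm <-; have [/(_ dm)[fV f1 _] _] := fyP m.
  by [].
have gy : g y = 1.
  apply: clim_unique (fg y) _; apply: eq_clim (clim_cst 1).
  by apply: filterS fP => m /= [_ [_ ->]].
have [|W dW [Wlim limW]] := IHs (fun m => V m :&: lker (ev y))%VS.
  by apply: filterS fP => m /= [dm [fV fy1]]; move: dm; rewrite (dim_cap_ev fV fy1) => -[].
have gW : (<[g]> :&: W = 0)%VS.
  apply/eqP; rewrite -subv0; apply/subvP => h /memv_capP[/vlineP[c ->] cW].
  have [u [uV uh]] := limW _ cW.
  suff -> : c = 0 by rewrite scale0r mem0v.
  have := uh y; rewrite scale_fspE gy mulr1 => /clim_unique; apply.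
  apply: eq_clim (clim_cst 0); apply: filterS uV => m /=.
  by rewrite memv_cap memv_ev => /andP[_ /eqP ->].
exists (<[g]> + W)%VS.
  rewrite dimv_disjoint_sum // dim_vline dW; case: eqP gy => // ->.
  by rewrite ffunE => /eqP; rewrite eq_sym oner_eq0.
split=> [u h uV uh|_ /memv_addP[_ /vlineP[c ->] [w wW ->]]].
  have -> : h = h y *: g + (h + (- h y) *: g) by rewrite scaleNr addrC subrK.
  apply: memv_add; first exact: memvZ (memv_line g).
  apply: (Wlim (fun m => u m + (-1 * u m y) *: f m)).
    apply: filterS2 fP uV => m /= [_ [fV fy1]] um.
    rewrite memv_cap memv_ev memvD ?memvZ //= !ffunE.
    by rewrite /GRing.scale /= fy1 mulr1 mulN1r subrr.
  apply: flimD => //; apply: flim_scale => //.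
  by have := climM (clim_cst (- 1)) (uh y); rewrite mulN1r.
have [u [uV uw]] := limW _ wW.
exists (fun m => c *: f m + u m); split; last first.
  by apply: flimD => //; apply: flim_scale => //; apply: clim_cst.
apply: filterS2 fP uV => m /= [_ [fV _]].
by rewrite memv_cap => /andP[um _]; rewrite memvD ?memvZ.
Qed.

End UltraLimits.

Section LimitTests.
Variables (R : realType) (U : set_system nat).
Hypothesis UU : UltraFilter U.
Local Notation F := R[i].
Let PU : ProperFilter U := ultra_proper.

(** Prolongations may converge as well: a limit of prolongations is a prolongation
    of the limit, and the dimension is kept by [limit_space_exists]. *)
Lemma test_limit (X Y : finType) (Sy : (X * Y -> X * Y) -> Prop)
    (E : nat -> {vspace fsp F Y}) (K : nat -> {vspace fsp F (X * Y)%type}) W s :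
  limit_space U E W ->
  (forall m, \dim (K m) = \dim (E m)) -> U [set m | \dim (E m) = s]%classic ->
  (forall m Q, Q \in K m -> prolongs Sy (E m) Q) ->
  test Sy W s.
Proof.
move=> [EW WE] dK dE KE.
have [|K' dK' [_ limK]] := @limit_space_exists R U UU (X * Y)%type s K.
  by apply: filterS dE => m /= <-.
exists K'; split=> [|Q /limK[u [uK uQ]]]; first by rewrite dK'.
split=> [p sp z|x].
  apply: (clim_unique UU) (uQ (p z)) _; apply: (eq_clim UU) (uQ z).
  by apply: filterS uK => m /= /KE[sy _]; rewrite (sy p sp z).
apply: (EW (fun m => slice x (u m))); first by apply: filterS uK => m /= /KE[_]; apply.
by move=> y; rewrite ffunE; apply: (eq_clim UU) (uQ (x, y)); apply: filterE => m /=; rewrite ffunE.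
Qed.

Lemma clim_cvg (u : nat -> (F : numFieldType)) (l : (F : numFieldType)) :
  (u m @[m --> \oo] --> l)%classic -> (\oo `<=` U)%classic -> clim U u l.
Proof.
move=> /cvgrPdist_lt ul ooU.
have re (e : R) : 0 < e -> U [set m | `|l - u m| < e%:C%C]%classic.
  by move=> e0; apply: ooU; apply: ul; rewrite ltcR.
have ReB (x y : F) : complex.Re x - complex.Re y = complex.Re (x - y).
  by case: x y => [? ?] [? ?].
have ImB (x y : F) : complex.Im x - complex.Im y = complex.Im (x - y).
  by case: x y => [? ?] [? ?].
split; apply/cvgrPdist_lt => e /re; apply: filterS => m /= h; rewrite -ltcR;
  apply: le_lt_trans h; rewrite ?ReB ?ImB; first exact: normc_ge_Re.
by rewrite normc_def lecR -sqrtr_sqr ler_wsqrtr // lerDr sqr_ge0.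
Qed.

End LimitTests.

Section Points.
Variables (F : fieldType) (A C : finType) (r : nat).
Notation Y := (A * C)%type.
Variables (a : 'I_r -> fsp F A) (c : 'I_r -> fsp F C).

Definition tens (X Z : finType) (x : fsp F X) (z : fsp F Z) : fsp F (X * Z)%type :=
  [ffun t => x t.1 * z t.2].

Let v p := tens (a p) (c p).

Lemma tens_neq0 (X Z : finType) (x : fsp F X) (z : fsp F Z) :
  x != 0 -> z != 0 -> tens x z != 0.
Proof.
move=> x0 z0; apply: contraNneq x0 => xz; apply/eqP/ffunP => i; rewrite ffunE.
apply/eqP; apply: contraNT z0 => xi; apply/eqP/ffunP => j; rewrite ffunE.
have /ffunP/(_ (i, j)) := xz; rewrite !ffunE /= => /eqP.
by rewrite mulf_eq0 (negPf xi) /= => /eqP.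
Qed.

Definition line_sum (Z : finType) (D : {set 'I_r}) (w : 'I_r -> fsp F Z) :=
  (\sum_(p in D) <[w p]>)%VS.

(** Passing to a minimal spanning subset keeps the span and makes the points
    independent, so that the higher tensor powers of these points span spaces of the
    same dimension. *)
Lemma independent_points : exists D : {set 'I_r},
  (forall p, v p \in line_sum D v) /\
  (forall l : 'I_r -> F, \sum_(p in D) l p *: v p = 0 -> forall p, p \in D -> l p = 0).
Proof.
pose ok (D : {set 'I_r}) := `[< forall p, v p \in line_sum D v >].
have okT : ok [set: 'I_r]%SET.
  by apply/asboolP => p; rewrite memvE; apply: (sumv_sup p); rewrite ?inE.
case: (arg_minnP (fun D : {set 'I_r} => #|D|) okT) => D /asboolP Dv min.
exists D; split=> // l l0 q qD; apply/eqP; apply: contraT => lq.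
have := min (D :\ q); rewrite (cardsD1 q D) qD add1n ltnn => /(_ _)/negP; case=> //.
have vq : v q \in line_sum (D :\ q) v.
  have -> : v q = \sum_(p in D :\ q) (- (l q)^-1 * l p) *: v p.
    move: l0; rewrite (bigD1 q) //= => /eqP; rewrite addr_eq0 => /eqP lv.
    rewrite -[v q]scale1r -(mulVf lq) -scalerA lv scalerN scaler_sumr -sumrN.
    apply: eq_big => [p|p _]; first by rewrite !inE andbC.
    by rewrite scalerA mulNr scaleNr.
  by apply: memv_suml => p pD; apply: memvZ; rewrite memvE; apply: (sumv_sup p).
apply/asboolP => p; move: (Dv p); apply: subvP; apply/subv_sumP => i iD.
rewrite -memvE; have [->//|iq] := eqVneq i q.
by rewrite memvE; apply: (sumv_sup i); rewrite // !inE iq.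
Qed.

Lemma dim_line_sum (Z : finType) (D : {set 'I_r}) (w : 'I_r -> fsp F Z) :
  (forall l : 'I_r -> F, \sum_(p in D) l p *: w p = 0 -> forall p, p \in D -> l p = 0) ->
  \dim (line_sum D w) = #|D|.
Proof.
move=> ind; apply/eqP; rewrite eqn_leq; apply/andP; split.
  apply: leq_trans (dimv_leq_sum _ _ _) _; rewrite -sum1_card; apply: leq_sum => p _.
  by rewrite dim_vline leq_b1.
apply: (@leq_trans #|[pred p in D]|); first by apply/eq_leq/eq_card.
apply: (dim_ge_indep (v := w)) => [p pD|l l0 p pD]; last exact: ind l0 p pD.
by rewrite memvE; apply: (sumv_sup p).
Qed.

Lemma tens_indep (X : finType) (x : 'I_r -> fsp F X) (D : {set 'I_r}) :
  (forall p, x p != 0) ->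
  (forall l : 'I_r -> F, \sum_(p in D) l p *: v p = 0 -> forall p, p \in D -> l p = 0) ->
  forall l : 'I_r -> F, \sum_(p in D) l p *: tens (x p) (v p) = 0 ->
  forall p, p \in D -> l p = 0.
Proof.
move=> x0 ind l l0 p pD; apply/eqP; apply: contraT => lp.
move/eqP: (x0 p); case; apply/ffunP => i; rewrite ffunE; apply/eqP.
have /(_ p pD)/eqP : forall p, p \in D -> l p * x p i = 0.
  apply: ind; apply/ffunP => y; have /ffunP/(_ (i, y)) := l0.
  rewrite sum_fspE [X in _ = X -> _]ffunE => l0y.
  rewrite sum_fspE [RHS]ffunE; apply: etrans l0y; apply: eq_bigr => q _.
  by rewrite !scale_fspE [tens _ _ (i, y)]ffunE mulrA.
by rewrite mulf_eq0 (negPf lp).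
Qed.

Lemma prolongs_points (X : finType) (Sy : (X * Y -> X * Y) -> Prop)
    (x : 'I_r -> fsp F X) (D : {set 'I_r}) Q :
  (forall q, Sy q -> forall p z, tens (x p) (v p) (q z) = tens (x p) (v p) z) ->
  Q \in line_sum D (fun p => tens (x p) (v p)) -> prolongs Sy (line_sum D v) Q.
Proof.
move=> sy /memv_sumP[w wl ->]; apply: prolongs_sum => p pD.
have /vlineP[t ->] := wl p pD; split=> [q qS z|i].
  by rewrite !scale_fspE sy.
have -> : slice i (t *: tens (x p) (v p)) = (t * x p i) *: v p.
  by apply/ffunP => y; rewrite ffunE !scale_fspE [tens _ _ (i, y)]ffunE mulrA.
by apply: memvZ; rewrite memvE; apply: (sumv_sup p).
Qed.

End Points.

(** ** The tests for the border rank *)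

Section BorderApolarity.
Variables (R : realType) (A J C : finType).
Local Notation F := R[i].
Notation Y := (A * C)%type.
Variable T : tensor F A J C.

Definition slice_span (f : fsp F Y) :=
  exists m : J -> F, f = [ffun y => \sum_j m j * T (y.1, j, y.2)].

(** A limit of sums of rank one tensors lies over a limit of the spaces spanned by
    their points; all the conditions that hold before the limit and are closed
    survive. *)
Theorem border_apolarity r : limit_of_rank r T ->
  exists s E, (s <= r)%N /\ apolar slice_span E s.
Proof.
move=> [S [Sr ST]].
have [U [UU ooU]] := @ultraFilterLemma nat \oo%classic _.
pose PU : ProperFilter U := ultra_proper.
pose data := (({ffun 'I_r -> fsp F A} * {ffun 'I_r -> fsp F C}) * {set 'I_r})%type.
pose vv (x : data) p := tens (x.1.1 p) (x.1.2 p).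
have dec m : exists x : data, [/\ forall p, x.1.1 p != 0, forall p, x.1.2 p != 0,
    forall j, [ffun y : Y => S m (y.1, j, y.2)] \in line_sum x.2 (vv x) &
    forall l : 'I_r -> F, \sum_(p in x.2) l p *: vv x p = 0 ->
      forall p, p \in x.2 -> l p = 0].
  have [P [P1 SP]] := Sr m.
  have /choice[abc abcP] : forall p, exists abc : {ffun A -> F} * {ffun J -> F} * {ffun C -> F},
      [/\ abc.1.1 != 0, abc.2 != 0 & P p = tprod abc.1.1 abc.1.2 abc.2].
    by move=> p; have [a [b [c [? ? ? ?]]]] := P1 p; exists (a, b, c).
  pose a p : fsp F A := (abc p).1.1; pose c p : fsp F C := (abc p).2.
  have [D [Dv ind]] := independent_points a c.
  pose x : data := ([ffun p => a p], [ffun p => c p], D).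
  have vvE q : vv x q = tens (a q) (c q) by rewrite /vv /x /= !ffunE.
  exists x; split.
  - by move=> p; rewrite ffunE; case: (abcP p).
  - by move=> p; rewrite ffunE; case: (abcP p).
  - move=> j.
    have -> : [ffun y : Y => S m (y.1, j, y.2)] = \sum_p (abc p).1.2 j *: tens (a p) (c p).
      apply/ffunP => y; rewrite sum_fspE ffunE SP sum_ffunE; apply: eq_bigr => p _.
      have [_ _ ->] := abcP p; rewrite scale_fspE !ffunE /=.
      by rewrite mulrCA mulrA.
    have -> : line_sum x.2 (vv x) = line_sum D (fun q => tens (a q) (c q)).
      by apply: eq_bigr => q _; rewrite vvE.
    by apply: memv_suml => p _; apply: memvZ; apply: Dv.
  move=> l l0; apply: ind; apply: etrans l0.
  by apply: eq_bigr => q _; rewrite vvE.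
have [x xP] := choice dec.
pose E m := line_sum (x m).2 (vv (x m)).
have [k kU] := ultra_fin UU (fun m => inord #|(x m).2| : 'I_r.+1).
have dE m : \dim (E m) = #|(x m).2| by apply: dim_line_sum; case: (xP m).
have kE : U [set m | \dim (E m) = k]%classic.
  apply: filterS kU => m /= <-; rewrite dE inordK // ltnS.
  by rewrite -[X in (_ <= X)%N]card_ord max_card.
have [W dW lW] := limit_space_exists UU kE.
exists k, W; split; first by rewrite -ltnS.
have dK (X : finType) (w : nat -> 'I_r -> fsp F X) m : (forall p, w m p != 0) ->
    \dim (line_sum (x m).2 (fun p => tens (w m p) (vv (x m) p))) = \dim (E m).
  move=> w0; rewrite dE; apply: dim_line_sum; apply: tens_indep => //.
  by case: (xP m).
split.
- by rewrite dW.
- move=> _ [cf ->]; apply: (proj1 lW (fun m => [ffun y => \sum_j cf j * S m (y.1, j, y.2)])).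
    apply: filterE => m /=.
    have -> : [ffun y : Y => \sum_j cf j * S m (y.1, j, y.2)] =
       \sum_j cf j *: ([ffun y : Y => S m (y.1, j, y.2)] : fsp F Y).
      apply/ffunP => y; rewrite sum_fspE ffunE; apply: eq_bigr => j _.
      by rewrite scale_fspE ffunE.
    by apply: memv_suml => j _; apply: memvZ; case: (xP m).
  move=> y; rewrite ffunE; apply: (eq_clim UU (u := fun m => \sum_j cf j * S m (y.1, j, y.2))).
    by apply: filterE => m /=; rewrite ffunE.
  elim: (index_enum J) => [|j js IHj].
    rewrite big_nil; apply: (eq_clim UU) (clim_cst UU 0).
    by apply: filterE => m /=; rewrite big_nil.
  rewrite big_cons; apply: (eq_clim UU) (climD UU (climM UU (clim_cst UU (cf j))
     (clim_cvg UU (ST (y.1, j, y.2)) ooU)) IHj).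
  by apply: filterE => m /=; rewrite big_cons.
- apply: (test_limit UU lW (K := fun m => line_sum (x m).2
    (fun p => tens ((x m).1.1 p) (vv (x m) p))) _ kE).
    by move=> m; apply: (dK _ (fun m p => (x m).1.1 p)); case: (xP m).
  move=> m Q; apply: prolongs_points => _ <- p z.
  by rewrite !ffunE /= mulrCA.
- apply: (test_limit UU lW (K := fun m => line_sum (x m).2
    (fun p => tens ((x m).1.2 p) (vv (x m) p))) _ kE).
    by move=> m; apply: (dK _ (fun m p => (x m).1.2 p)); case: (xP m).
  move=> m Q; apply: prolongs_points => _ <- p z.
  by rewrite !ffunE /=; ring.
apply: (test_limit UU lW (K := fun m => line_sum (x m).2
    (fun p => tens (vv (x m) p) (vv (x m) p))) _ kE).
  move=> m; apply: (dK _ (fun m p => vv (x m) p)) => p.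
  by case: (xP m) => a0 c0 _ _; apply: tens_neq0.
by move=> m Q; apply: prolongs_points => _ [] -> p z; rewrite !ffunE /=; ring.
Qed.

End BorderApolarity.

(** * Counting along a row or a column *)

(** The bound for the prolongations of a single column of blocks with levels [f]. *)
Definition kappa n (f : 'I_n -> nat) : nat :=
  \sum_(j < n) \sum_(j' < n)
    if (j < j')%N then num21 (f j) (f j') else if j == j' then num20 (f j) else 0%N.

Definition nlev n (f : 'I_n -> nat) l : nat := \sum_j (f j == l).

Lemma sum_lev n (f : 'I_n -> nat) (G : nat -> nat) : (forall j, f j <= 3)%N ->
  (\sum_j G (f j) =
   nlev f 0 * G 0 + nlev f 1 * G 1 + nlev f 2 * G 2 + nlev f 3 * G 3)%N.
Proof.
move=> f3; rewrite /nlev !big_distrl -!big_split /=; apply: eq_bigr => j _.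
by have := f3 j; case: (f j) => [|[|[|[|]]]] //= _; rewrite ?mul0n ?mul1n ?addn0.
Qed.

Lemma nlev_total n (f : 'I_n -> nat) : (forall j, f j <= 3)%N ->
  (nlev f 0 + nlev f 1 + nlev f 2 + nlev f 3 = n)%N.
Proof.
move=> f3; have := sum_lev (fun=> 1%N) f3.
by rewrite big_const_ord iter_addn_0 mul1n !muln1 => <-.
Qed.

Definition pair_num l l' : nat :=
  nth 0 (nth [::] [:: [:: 0; 0; 1; 2]; [:: 0; 2; 3; 4]; [:: 1; 3; 5; 6];
                      [:: 2; 4; 6; 8]] l) l'.

Lemma num21E l l' : (l' <= l <= 3)%N -> num21 l l' = pair_num l l'.
Proof.
by case/andP; case: l => [|[|[|[|//]]]]; case: l' => [|[|[|[|//]]]] // _ _;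
   rewrite /num21 !big_cons !big_nil.
Qed.

Lemma num20E l : (l <= 3)%N -> num20 l = nth 0%N [:: 0; 2; 4; 6]%N l.
Proof. by case: l => [|[|[|[|//]]]] _; rewrite /num20 !big_cons !big_nil. Qed.

Lemma pair_numC l l' : (l <= 3)%N -> (l' <= 3)%N -> pair_num l l' = pair_num l' l.
Proof. by case: l => [|[|[|[|//]]]]; case: l' => [|[|[|[|//]]]]. Qed.

(** Symmetrising the sum over pairs turns it into a quadratic form in the
    numbers of entries of each level. *)
Lemma kappaE n (f : 'I_n -> nat) (z := nlev f 0) (a := nlev f 1) (b := nlev f 2)
    (q := nlev f 3) :
  (forall j, f j <= 3)%N -> (forall j j' : 'I_n, (j <= j')%N -> (f j' <= f j)%N) ->
  (2 * kappa f = 8 * (q * q) + 5 * (b * b) + 2 * (a * a) +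
     2 * (6 * (q * b) + 4 * (q * a) + 3 * (a * b)) +
     4 * (q * z) + 2 * (b * z) + 4 * q + 3 * b + 2 * a)%N.
Proof.
move=> f3 fm; pose dg l := nth 0%N [:: 0; 2; 3; 4]%N l.
have -> : (2 * kappa f = \sum_j \sum_j' pair_num (f j) (f j') + \sum_j dg (f j))%N.
  rewrite mul2n -addnn /kappa {2}exchange_big -!big_split /=.
  apply: eq_bigr => j _; rewrite -!big_split /=.
  rewrite [dg _](_ : _ = \sum_(j' < n) if j == j' then dg (f j) else 0)%N; last first.
    by rewrite -big_mkcond (big_pred1 j) // => j'; rewrite eq_sym.
  rewrite -big_split /=; apply: eq_bigr => j' _.
  case: (ltngtP j j') => [jj|jj|/val_inj <-].
  - have jj' : (j == j') = false by apply/eqP => e; rewrite e ltnn in jj.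
    rewrite jj' eq_sym jj' !addn0.
    by rewrite num21E ?fm ?f3 // ltnW.
  - have jj' : (j == j') = false by apply/eqP => e; rewrite e ltnn in jj.
    rewrite jj' add0n addn0.
    by rewrite num21E ?fm ?f3 1?pair_numC // ltnW.
  rewrite eqxx num20E //.
  by have := f3 j; case: (f j) => [|[|[|[|]]]].
have E j : (\sum_j' pair_num (f j) (f j') = z * pair_num (f j) 0 + a * pair_num (f j) 1
   + b * pair_num (f j) 2 + q * pair_num (f j) 3)%N.
  exact: sum_lev.
rewrite (eq_bigr _ (fun j _ => E j)) !big_split /= -!big_distrr /=.
rewrite !(sum_lev (fun l => pair_num l _)) // (sum_lev dg) //.
rewrite /dg /pair_num /= -/z -/a -/b -/q; lia.
Qed.

(** * Level diagrams and their rows *)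

Section Diagrams.
Variable n : nat.
Implicit Types (d : 'I_n -> 'I_n -> nat).

Definition total d : nat := \sum_(j < n) \sum_(k < n) d j k.

Definition bound21 d : nat := \sum_(k < n) kappa (fun j => d j k).

Definition bound22 d : nat :=
  \sum_(j < n) \sum_(j' < n) \sum_(k < n) \sum_(k' < n)
     if ((j <= j') && (k <= k'))%N then
       num22 (d j k) (d j k') (d j' k) (d j' k') (j == j') (k == k')
     else 0%N.

Definition transpose d : 'I_n -> 'I_n -> nat := fun j k => d k j.

(** The numerical conditions that border apolarity imposes on the levels. *)
Definition admissible d s :=
  [/\ monotone_levels d, (n * n + total d <= s)%N,
      (s <= bound21 d)%N /\ (s <= bound21 (transpose d))%N &
      (s <= bound22 d)%N /\ (s <= bound22 (transpose d))%N].

Lemma total_transpose d : total (transpose d) = total d.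
Proof. by rewrite /total exchange_big. Qed.

Lemma admissible_transpose d s : admissible d s -> admissible (transpose d) s.
Proof.
move=> [[d3 dm] ds [? ?] [? ?]]; split=> //; last by rewrite total_transpose.
by split=> *; [apply: d3 | apply: dm].
Qed.

Lemma tests_admissible (F : fieldType) d s : monotone_levels d ->
  (n * n + total d <= s)%N -> level_tests F d s -> admissible d s.
Proof.
move=> md ds t; have [mt t'] : monotone_levels (transpose d) /\ level_tests F (transpose d) s.
  by split; [case: md => d3 dm; split=> *; [apply: d3|apply: dm] | apply: level_tests_transp].
have B21 d' : monotone_levels d' -> level_tests F d' s -> (s <= bound21 d')%N.
  move=> m' [E [lE t1 _ _]]; apply: leq_trans (count21 m' lE t1) _.
  rewrite /bound21 /kappa [X in (_ <= X)%N]exchange_big leq_eqVlt; apply/orP; left.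
  apply/eqP; apply: eq_bigr => j _; rewrite [RHS]exchange_big.
  by apply: eq_bigr => j' _; apply: eq_bigr.
have B22 d' : monotone_levels d' -> level_tests F d' s -> (s <= bound22 d')%N.
  by move=> m' [E [lE _ _ t3]]; apply: count22 m' lE t3.
by split=> //; split; [exact: B21|exact: B21|exact: B22|exact: B22].
Qed.

End Diagrams.

(** A row is nonincreasing, so the numbers of its entries that are at least 1, 2
    and 3 determine it; in these coordinates the order of rows is componentwise and
    [kappa] is a quadratic polynomial. *)
Definition profile := (nat * nat * nat)%type.

Definition psum (p : profile) : nat := p.1.1 + p.1.2 + p.2.
Definition pfst (p : profile) : nat := (0 < p.1.1) + (0 < p.1.2) + (0 < p.2).
Definition plev (p : profile) k : nat := (k < p.1.1) + (k < p.1.2) + (k < p.2).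
Definition ple (p p' : profile) := [&& p.1.1 <= p'.1.1, p.1.2 <= p'.1.2 & p.2 <= p'.2]%N.
Definition p0 : profile := (0, 0, 0)%N.

Local Open Scope Z_scope.
Local Notation zn := Z.of_nat.

(** Twice [kappa], by [kappaE]; the factor clears a denominator. *)
Definition kap2 (n : nat) (p : profile) : Z :=
  let a := zn p.1.1 - zn p.1.2 in let b := zn p.1.2 - zn p.2 in
  let q := zn p.2 in let n := zn n in
  4 * q * q + 4 * q + 3 * b * b + 3 * b + 2 * a * a + 2 * a + 6 * q * b +
  4 * q * a + 4 * a * b + 4 * n * q + 2 * n * b.

(** The quadratic bound on the row [p] is replaced by a linear one, in the total
    and the first entry of [p]; this is the slack. The line is chosen to be exact
    on rows of entries 3 of length 1 and of total [m], the extreme cases for rows of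
    total at most [m]. The first entries then add up to the first column. *)
Definition loss (n m : nat) (p : profile) : Z :=
  (4 * (zn m + 3) + 12 * (zn n + 1)) * zn (psum p) - 4 * zn m * zn (pfst p)
  - 9 * kap2 n p.

(** What is left for the slacks of all rows of a diagram of total [rho], with first
    row [m] and first column [M], if the bound on the rows is to reach
    [n ^ 2 + rho]. *)
Definition budget (n rho m M : nat) : Z :=
  (4 * zn m + 12 * zn n + 6) * zn rho - 4 * zn m * zn M - 18 * zn n * zn n.

Lemma loss0 n m : loss n m p0 = 0.
Proof.
have -> : loss n m p0 = (4 * (zn m + 3) + 12 * (zn n + 1)) * 0 - 4 * zn m * 0 - 9 *
  (4 * zn n * 0 + 2 * zn n * 0) by [].
ring.
Qed.

(** In terms of the numbers [a, b, q] of entries 1, 2, 3, the loss is a sum of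
    products of nonnegative terms as soon as rows are short compared to [n]. *)
Lemma loss_ge0 n m p : (7 * m + 3 <= 6 * n)%N -> (p.2 <= p.1.2 <= p.1.1)%N ->
  (psum p <= m)%N -> 0 <= loss n m p.
Proof.
case: p => [[x1 x2] x3] mn /andP[/= h32 h21]; rewrite /psum /= => sm.
pose a := zn x1 - zn x2; pose b := zn x2 - zn x3; pose q := zn x3.
pose r := a + 2 * b + 3 * q; pose e := zn (pfst (x1, x2, x3)).
have a0 : 0 <= a by rewrite /a; lia.
have b0 : 0 <= b by rewrite /b; lia.
have q0 : 0 <= q by rewrite /q; lia.
have rm : r <= zn m by rewrite /r /a /b /q; lia.
have fs : (pfst (x1, x2, x3) <= x1 + x2 + x3)%N && (pfst (x1, x2, x3) <= 3)%N.
  by rewrite /pfst /=; case: x1 x2 x3 {a b q r e a0 b0 q0 rm sm h32 h21} => [|?] [|?] [|?]; lia.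
have er : e <= r /\ 0 <= e <= 3 by rewrite /e /r /a /b /q; lia.
have -> : loss n m (x1, x2, x3) =
    ((2 * a + b) * (6 * zn n - 3 - (7 * a + 11 * b + 6 * q)) + 9 * a * b) +
    4 * ((r - e) * (zn m - r)) + 4 * ((3 - e) * r).
  have -> : loss n m (x1, x2, x3) = (4 * (zn m + 3) + 12 * (zn n + 1)) * zn (psum (x1, x2, x3))
    - 4 * zn m * e - 9 * (4 * q * q + 4 * q + 3 * b * b + 3 * b + 2 * a * a + 2 * a + 6 * q * b +
  4 * q * a + 4 * a * b + 4 * zn n * q + 2 * zn n * b) by [].
  have -> : zn (psum (x1, x2, x3)) = r by rewrite /psum /= /r /a /b /q; lia.
  by rewrite /r; ring.
have ge1 : 0 <= 6 * zn n - 3 - (7 * a + 11 * b + 6 * q).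
  by move: rm; rewrite /r; clearbody a b q; lia.
have H1 := Z.mul_nonneg_nonneg (2 * a + b) _ ltac:(lia) ge1.
have H2 := Z.mul_nonneg_nonneg a b a0 b0.
have H3 := Z.mul_nonneg_nonneg (r - e) (zn m - r) ltac:(lia) ltac:(lia).
have H4 := Z.mul_nonneg_nonneg (3 - e) r ltac:(lia) ltac:(lia).
lia.
Qed.

Local Close Scope Z_scope.

Local Arguments Z.mul : simpl never.
Local Arguments Z.add : simpl never.
Local Arguments Z.sub : simpl never.
Local Arguments Z.of_nat : simpl never.

(** * Searching the diagrams with a prescribed sum *)

Section Search.
Local Open Scope Z_scope.
Variables (n m : nat) (prune : bool) (Q : seq profile) (leaf : seq profile -> bool).

(** Depth-first enumeration of the rows below [prev] that complete the rows [acc]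
    to a diagram with remaining total [t], remaining first column [c] and remaining
    budget [bud]. When all losses are nonnegative, [prune] cuts a branch as soon as
    the budget is exhausted. *)
Fixpoint search (fuel : nat) (prev : profile) (t c : nat) (bud : Z)
    (acc : seq profile) : bool :=
  if prune && Z.ltb bud 0 then true
  else if t == 0%N then [|| c != 0%N, Z.ltb bud 0 | leaf (rev acc)]
  else if fuel is fuel'.+1 then
    all (fun p => if [&& ple p prev, psum p <= t & pfst p <= c]%N then
      search fuel' p (t - psum p)%N (c - pfst p)%N (bud - loss n m p) (p :: acc)
      else true) Q
  else false.

Definition zsum (f : profile -> Z) (L : seq profile) : Z :=
  foldr (fun p s => f p + s) 0 L.

Lemma zsum_ge0 f L : (forall p, p \in L -> 0 <= f p) -> 0 <= zsum f L.
Proof.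
elim: L => [|p L IHL] f0; first by rewrite /=; lia.
have := f0 p (mem_head _ _).
have {}H : 0 <= zsum f L by apply: IHL => q qL; apply: f0; rewrite in_cons qL orbT.
by move=> /=; lia.
Qed.

Lemma psum_eq0 p : psum p = 0%N -> p = p0.
Proof.
by case: p => [[x1 x2] x3]; rewrite /psum /p0 /= => h; congr (_, _, _); lia.
Qed.

Lemma zero_rows L : sumn (map psum L) = 0%N ->
  [/\ L = nseq (size L) p0, sumn (map pfst L) = 0%N & zsum (loss n m) L = 0].
Proof.
elim: L => [|p L IHL] //= s0.
have p00 : p = p0 by apply: psum_eq0; lia.
have [e1 e2 e3] : [/\ L = nseq (size L) p0, sumn (map pfst L) = 0%N & zsum (loss n m) L = 0].
  by apply: IHL; lia.
by split; [rewrite p00 {1}e1 | rewrite e2 p00 | rewrite e3 p00 loss0].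
Qed.

Lemma search_sound fuel L acc prev t c bud :
  path (fun p q => ple q p) prev L ->
  (forall p, p \in L -> (0 < psum p)%N -> p \in Q) ->
  sumn (map psum L) = t -> sumn (map pfst L) = c -> zsum (loss n m) L <= bud ->
  (prune -> forall p, p \in L -> 0 <= loss n m p) ->
  (t <= fuel)%N -> search fuel prev t c bud acc ->
  exists L' k, L = L' ++ nseq k p0 /\ leaf (rev acc ++ L').
Proof.
elim: fuel L acc prev t c bud => [|fuel IH] L acc prev t c bud pL LQ st sc sb pos tf.
  have t0 : t = 0%N by lia.
  rewrite /= t0 eqxx; have [] := @zero_rows L; first by rewrite st t0.
  move=> LE c0 l0; case: ifP => [/andP[pr /Z.ltb_spec0 b0]|_]; first by lia.
  rewrite -sc c0 /=; case/orP => [/Z.ltb_spec0|lf]; first by lia.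
  by exists [::], (size L); rewrite cats0.
rewrite /=; case: ifP => [/andP[pr /Z.ltb_spec0 b0]|_].
  by have := zsum_ge0 (pos pr); lia.
case: eqP => [t0|t0].
  have [] := @zero_rows L; first by rewrite st t0.
  move=> LE c0 l0; rewrite -sc c0 /=; case/orP => [/Z.ltb_spec0|lf]; first by lia.
  by exists [::], (size L); rewrite cats0.
case: L pL LQ st sc sb pos => [|p L] /= pL LQ st sc sb pos; first by lia.
have /andP[pp pL'] := pL.
have pn : (0 < psum p)%N.
  rewrite lt0n; apply/eqP => p00; have : sumn (map psum L) = 0%N; last by lia.
  have {pp pL'} : path (fun p q => ple q p) p0 L by rewrite -(psum_eq0 p00).
  elim: L {pL LQ st sc sb pos} => [|q L IHL] //= /andP[qp qL].
  have q0 : q = p0.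
    by apply: psum_eq0; move: qp => /and3P[/=]; rewrite /psum; lia.
  by rewrite IHL -?q0 // q0.
move=> /allP/(_ p (LQ p (mem_head _ _) pn)).
have -> : [&& ple p prev, psum p <= t & pfst p <= c]%N by rewrite pp; lia.
have LQ' q : q \in L -> (0 < psum q)%N -> q \in Q.
  by move=> qL; apply: LQ; rewrite in_cons qL orbT.
have pos' : prune -> forall q, q \in L -> 0 <= loss n m q.
  by move=> pr q qL; apply: pos => //; rewrite in_cons qL orbT.
move=> sr; have [||||L' [k [LE lf]]] := IH L _ _ _ _ _ pL' LQ' _ _ _ pos' _ sr; try lia.
by exists (p :: L'), k; rewrite LE /= -cat_rcons -rev_cons.
Qed.

End Search.

Definition profiles m : seq profile :=
  flatten [seq flatten [seq [seq (x1, x2, x3) | x1 <- iota x2 (m - x2 - x3 - x2).+1]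
                          | x2 <- iota x3 (m - x3 - x3).+1] | x3 <- iota 0 m.+1].

Lemma mem_profiles m p : (p.2 <= p.1.2 <= p.1.1)%N -> (psum p <= m)%N -> p \in profiles m.
Proof.
case: p => [[x1 x2] x3] /=; rewrite /psum /= => /andP[h1 h2] sm.
apply/flattenP; eexists; first by apply/mapP; exists x3 => //; rewrite mem_iota; lia.
apply/flattenP; eexists; first by apply/mapP; exists x2 => //; rewrite mem_iota; lia.
by apply/mapP; exists x1 => //; rewrite mem_iota; lia.
Qed.

(* Big operators are locked; sums over lists compute. *)
Definition num22c w x y z ej ek : nat :=
  sumn [seq sumn [seq sumn [seq sumn [seq nat_of_bool (det22 w x y z ej ek a b c e)
    | e <- bits] | c <- bits] | b <- bits] | a <- bits].

Lemma num22E w x y z ej ek : num22 w x y z ej ek = num22c w x y z ej ek.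
Proof.
rewrite /num22c /num22 sumnE big_map; apply: eq_bigr => a _.
rewrite sumnE big_map; apply: eq_bigr => b _.
by rewrite sumnE big_map; apply: eq_bigr => c _; rewrite sumnE big_map.
Qed.

Section Leaf.
Variables (n rho : nat).

Definition level_of (L : seq profile) i k : nat := plev (nth p0 L i) k.

Definition column (L : seq profile) k : profile :=
  (count (fun p => k < p.1.1) L, count (fun p => k < p.1.2) L, count (fun p => k < p.2) L)%N.

Definition column_value (L : seq profile) : Z :=
  foldr (fun k s => Z.add (kap2 n (column L k)) s) Z0 (iota 0 (head p0 L).1.1).

Definition value22 (L : seq profile) : nat :=
  let R := iota 0 (size L) in let K := iota 0 (head p0 L).1.1 in
  sumn [seq sumn [seq sumn [seq sumn [seq
    if ((j <= j') && (k <= k'))%N then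
      num22c (level_of L j k) (level_of L j k') (level_of L j' k) (level_of L j' k')
        (j == j') (k == k') else 0%N
    | k' <- K] | k <- K] | j' <- R] | j <- R].

(** The search only takes the bound on rows into account; this tests the bounds on
    columns and on quadruples of blocks. Rows and columns of zeros are left out of
    [L] and contribute nothing. *)
Definition excluded (L : seq profile) : bool :=
  Z.ltb (column_value L) (Z.mul 2 (Z.of_nat (n * n + rho))) || (value22 L < n * n + rho)%N.

(** The search over diagrams of total [rho] with first row of total [m]. By
    transposition the first column has total [M] at least [m]; they share a single
    entry, at most 3, hence [m + M <= rho + 3]. *)
Definition check_row (prune : bool) m : bool :=
  let top := budget n rho m m in
  (~~ prune || (7 * m + 3 <= 6 * n)%N) &&
  if prune && Z.ltb top Z0 then true else
  let Q := [seq p <- profiles m | (0 < psum p)%N &&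
              (~~ prune || Z.leb (loss n m p) top)] in
  all (fun M => all (fun p =>
    if (psum p == m) && (pfst p <= M)%N then
      search n m prune Q excluded rho p (rho - m) (M - pfst p)
        (Z.sub (budget n rho m M) (loss n m p)) [:: p]
    else true) Q) (iota m (rho + 4 - m - m)).

Definition check (prune : bool) : bool :=
  all (check_row prune) (iota 1 (rho + 3)./2).

End Leaf.

(** ** Soundness *)

Definition nge n (f : 'I_n -> nat) l : nat := \sum_k (l <= f k)%N.

Definition prof n (f : 'I_n -> nat) : profile := (nge f 1, nge f 2, nge f 3).

Lemma sum_ltn n c : (\sum_(j < n) (j < c) = minn n c)%N.
Proof.
elim: n => [|n IHn]; first by rewrite big_ord0 min0n.
by rewrite big_ord_recr /= IHn; case: ltnP => ?; lia.
Qed.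

Section Profiles.
Variables (n : nat) (f : 'I_n -> nat).
Hypothesis f3 : forall j, (f j <= 3)%N.
Hypothesis fm : forall j j' : 'I_n, (j <= j')%N -> (f j' <= f j)%N.

Lemma nge_lt l (k : 'I_n) : (k < nge f l)%N = (l <= f k)%N.
Proof.
apply/idP/idP => [|lk]; last first.
  apply: (@leq_trans (\sum_(j < n) (j < k.+1))%N).
    by rewrite sum_ltn; have := ltn_ord k; lia.
  apply: leq_sum => j _; case: ltnP => // jk; rewrite (leq_trans lk) //.
  by apply: fm; rewrite -ltnS.
apply: contraTT; rewrite -!ltnNge => kl; rewrite ltnS.
apply: (@leq_trans (\sum_(j < n) (j < k))%N); last by rewrite sum_ltn geq_minr.
apply: leq_sum => j _; case: (ltnP j k) => [_|kj]; first exact: leq_b1.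
by rewrite [(l <= _)%N]leqNgt (leq_ltn_trans (fm kj) kl).
Qed.

Lemma nge_le l : (nge f l <= n)%N.
Proof.
rewrite -[X in (_ <= X)%N](minnn n) -sum_ltn; apply: leq_sum => j _.
by rewrite ltn_ord; exact: leq_b1.
Qed.

Lemma plev_prof (k : 'I_n) : plev (prof f) k = f k.
Proof.
rewrite /plev /= !nge_lt.
by have := f3 k; case: (f k) => [|[|[|[|]]]].
Qed.

Lemma psum_prof : psum (prof f) = (\sum_k f k)%N.
Proof.
rewrite /psum /prof /= /nge -!big_split; apply: eq_bigr => k _ /=.
by have := f3 k; case: (f k) => [|[|[|[|]]]].
Qed.

Lemma prof_chain : ((prof f).2 <= (prof f).1.2 <= (prof f).1.1)%N.
Proof.
by apply/andP; split; apply: leq_sum => k _; case: (f k) => [|[|[|]]].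
Qed.

Lemma kap2_prof : kap2 n (prof f) = Z.of_nat (2 * kappa f).
Proof.
have E1 : nge f 1 = (nlev f 1 + nlev f 2 + nlev f 3)%N.
  rewrite /nge /nlev -!big_split; apply: eq_bigr => k _ /=.
  by have := f3 k; case: (f k) => [|[|[|[|]]]].
have E2 : nge f 2 = (nlev f 2 + nlev f 3)%N.
  rewrite /nge /nlev -!big_split; apply: eq_bigr => k _ /=.
  by have := f3 k; case: (f k) => [|[|[|[|]]]].
have E3 : nge f 3 = nlev f 3.
  by apply: eq_bigr => k _ /=; have := f3 k; case: (f k) => [|[|[|[|]]]].
have := nlev_total f3; rewrite kappaE // /kap2 /prof /=.
move: (nlev f 0) (nlev f 1) (nlev f 2) (nlev f 3) E1 E2 E3 => z a b q -> -> -> <-.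
lia.
Qed.

End Profiles.

Lemma sum_cut (G : nat -> nat) R n : (R <= n)%N -> (forall j, (R <= j)%N -> G j = 0%N) ->
  (\sum_(j < n) G j = sumn [seq G j | j <- iota 0 R])%N.
Proof.
move=> Rn G0; rewrite sumnE big_map -[R in iota 0 R]subn0 -/(index_iota 0 R).
rewrite -(big_mkord xpredT G) (big_cat_nat (n := R)) //=.
have -> : (\sum_(R <= j < n) G j = 0)%N.
  by rewrite big_nat_cond big1 // => j /andP[/andP[Rj _] _]; apply: G0.
by rewrite addn0.
Qed.

Section Rows.
Variables (n' s : nat).
Notation n := n'.+1.
Variable d : 'I_n -> 'I_n -> nat.
Hypothesis ad : admissible d s.
Let d3 : forall j k, (d j k <= 3)%N. Proof. by case: ad => [[]]. Qed.
Let dm (j j' k k' : 'I_n) : (j <= j')%N -> (k <= k')%N -> (d j' k' <= d j k)%N.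
Proof. by case: ad => [[_ h] _ _ _]; apply: h. Qed.

Let rho := total d.
Let m := (\sum_k d ord0 k)%N.
Let M := (\sum_j d j ord0)%N.
Hypothesis mM : (m <= M)%N.

Let row (i : 'I_n) : profile := prof (d i).
Let L := [seq row i | i <- enum 'I_n].

Let row_mono i : forall k k' : 'I_n, (k <= k')%N -> (d i k' <= d i k)%N.
Proof. by move=> k k'; apply: dm. Qed.

Lemma psum_row i : psum (row i) = (\sum_k d i k)%N.
Proof. exact: psum_prof. Qed.

Lemma pfst_row i : pfst (row i) = d i ord0.
Proof. by rewrite -(plev_prof (d3 i) (@row_mono i) ord0). Qed.

Lemma first_row_col : (m + M <= rho + 3)%N.
Proof.
rewrite /rho /total big_ord_recl /= -/m /M big_ord_recl /=.
have : (\sum_(i < n') d (lift ord0 i) ord0 <=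
        \sum_(i < n') \sum_(k < n) d (lift ord0 i) k)%N.
  by apply: leq_sum => i _; rewrite [X in (_ <= X)%N]big_ord_recl leq_addr.
have := d3 ord0 ord0; set X := \sum_(i < n') d _ _; set Z := \sum_(i < n') _.
by move: m (d ord0 ord0) X Z => m0 c X Z; lia.
Qed.

Lemma row_le i : (psum (row i) <= m)%N.
Proof. by rewrite psum_row; apply: leq_sum => k _; apply: dm. Qed.

Lemma sum_kappa : (n * n + rho <= \sum_i kappa (d i))%N.
Proof. by case: ad => [_ ds [_ h] _]; apply: leq_trans ds h. Qed.

Lemma zsum_loss : Z.le (zsum (loss n m) L) (budget n rho m M).
Proof.
have H (t : seq 'I_n) : zsum (loss n m) (map row t) = Z.sub (Z.sub
    (Z.mul (Z.add (Z.mul 4 (Z.add (Z.of_nat m) 3)) (Z.mul 12 (Z.add (Z.of_nat n) 1)))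
      (Z.of_nat (\sum_(i <- t) psum (row i))))
    (Z.mul (Z.mul 4 (Z.of_nat m)) (Z.of_nat (\sum_(i <- t) pfst (row i)))))
    (Z.mul 18 (Z.of_nat (\sum_(i <- t) kappa (d i)))).
  elim: t => [|i t IHt].
    by rewrite !big_nil (_ : Z.of_nat 0 = Z0) // [zsum _ _]/=; ring.
  rewrite /= IHt !big_cons /loss (kap2_prof (d3 i) (@row_mono i)).
  move: (\sum_(_ <- t) psum _)%N (\sum_(_ <- t) pfst _)%N (\sum_(_ <- t) kappa _)%N.
  move: (psum _) (pfst _) (kappa _) (Z.of_nat m) (Z.of_nat n) => a b c zm zn A B K.
  have -> : Z.of_nat (a + A) = Z.add (Z.of_nat a) (Z.of_nat A) by lia.
  have -> : Z.of_nat (b + B) = Z.add (Z.of_nat b) (Z.of_nat B) by lia.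
  have -> : Z.of_nat (c + K) = Z.add (Z.of_nat c) (Z.of_nat K) by lia.
  have -> : Z.of_nat (2 * c) = Z.mul 2 (Z.of_nat c) by lia.
  ring.
rewrite /L H !big_enum /=.
have -> : (\sum_i psum (row i) = rho)%N by apply: eq_bigr => i _; apply: psum_row.
have -> : (\sum_i pfst (row i) = M)%N by apply: eq_bigr => i _; apply: pfst_row.
have := sum_kappa; rewrite /budget.
by move: rho m M (\sum_i kappa _)%N => r0 m0 M0 K0; nia.
Qed.

(** Ignoring the losses, the budget must be nonnegative; since [m <= M] it is at
    most its value at [M = m], where [4 * m * (rho - m) <= rho ^ 2]. *)
Lemma plain_bound : (7 * m + 3 <= 6 * n)%N ->
  (18 * (n * n) <= rho * rho + (12 * n + 6) * rho)%N.
Proof.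
move=> mn.
have pos : Z.le 0 (zsum (loss n m) L).
  apply: zsum_ge0 => _ /mapP[i _ ->]; apply: loss_ge0 => //; first exact: prof_chain.
  exact: row_le.
have := zsum_loss; rewrite /budget => zl.
have h : Z.le 0 (Z.mul (Z.of_nat m) (Z.sub (Z.of_nat M) (Z.of_nat m))).
  by apply: Z.mul_nonneg_nonneg; lia.
have h2 : Z.le 0 (Z.mul (Z.sub (Z.of_nat rho) (Z.mul 2 (Z.of_nat m)))
                        (Z.sub (Z.of_nat rho) (Z.mul 2 (Z.of_nat m)))).
  exact: Z.square_nonneg.
lia.
Qed.

Lemma row_chain : path (fun p q => ple q p) (row ord0) (behead L).
Proof.
have LE : L = row ord0 :: behead L by rewrite /L enum_ordSl.
suff : sorted (fun p q => ple q p) L by rewrite LE.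
rewrite /L sorted_map.
apply: (@sub_sorted _ (fun i j : 'I_n => (i <= j)%N)).
  move=> i j ij; apply/and3P; split; apply: leq_sum => k _ /=;
    have := dm ij (leqnn k); do 2 (case: (leqP _ _) => //); lia.
have := iota_sorted 0 n; rewrite -val_enum_ord sorted_map.
by apply: sub_sorted.
Qed.

(** The search stops at the first zero row: the remaining rows are zero. *)
Section Trim.
Variables (L' : seq profile) (z : nat).
Hypothesis LL' : L = L' ++ nseq z p0.
Hypothesis L'0 : L' != [::].

Let K := (head p0 L').1.1.

Lemma nth_rows (i : 'I_n) : nth p0 L' i = row i.
Proof.
have <- : nth p0 L i = row i by rewrite (nth_map ord0) ?size_enum_ord // nth_ord_enum.
by rewrite LL' nth_cat nth_nseq; case: ltnP => // ?; rewrite nth_default ?if_same.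
Qed.

Lemma level_of_rows (i k : 'I_n) : level_of L' i k = d i k.
Proof. by rewrite /level_of nth_rows (plev_prof (d3 i) (@row_mono i)). Qed.

Lemma size_rows : (size L' <= n)%N.
Proof.
by have := congr1 size LL'; rewrite size_cat size_map size_enum_ord; lia.
Qed.

Lemma head_rows : head p0 L' = row ord0.
Proof. by rewrite -nth0 (nth_rows ord0). Qed.

Lemma head_max p : p \in L' -> [/\ p.1.1 <= K, p.1.2 <= K & p.2 <= K]%N.
Proof.
move=> pL; have : p \in L by rewrite LL' mem_cat pL.
case/mapP=> i _ ->; rewrite /K head_rows /row /prof /=.
have := prof_chain (d i); rewrite /prof /= => /andP[h1 h2].
suff h : (nge (d i) 1 <= nge (d ord0) 1)%N by split; lia.
by apply: leq_sum => k _; have := dm (leq0n i : ord0 <= i)%N (leqnn k); case: (d i k) (d ord0 k) => [|?] [|?].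
Qed.

Lemma K_le : (K <= n)%N.
Proof. by rewrite /K head_rows /= nge_le. Qed.

Lemma column_rows (k : 'I_n) : column L' k = prof (fun j => d j k).
Proof.
have cnt (f : profile -> nat) l : f p0 = 0%N ->
    (forall i, f (row i) = nge (d i) l) ->
    count (fun p => (k < f p)%N) L' = nge (fun j => d j k) l.
  move=> f0 fE.
  have -> : count (fun p => (k < f p)%N) L' = count (fun p => (k < f p)%N) L.
    by rewrite LL' count_cat count_nseq f0 mul0n addn0.
  rewrite /L count_map -sum1_count big_mkcond big_enum /=; apply: eq_bigr => i _.
  by rewrite fE (nge_lt (@row_mono i)); case: (_ <= _)%N.
by rewrite /column /prof; congr (_, _, _);
  [apply: (cnt (fun p => p.1.1)) | apply: (cnt (fun p => p.1.2)) | apply: (cnt (fun p => p.2))].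
Qed.

Lemma column_value_rows : column_value n L' = Z.of_nat (2 * bound21 d).
Proof.
pose g k := kap2 n (column L' k).
have g0 k : (K <= k)%N -> g k = Z0.
  move=> Kk; rewrite /g; have -> : column L' k = p0.
    by rewrite /column /p0; congr (_, _, _); apply/eqP;
       rewrite -leqn0 leqNgt -has_count; apply/hasPn => p /head_max[? ? ?];
       rewrite /= -leqNgt (leq_trans _ Kk).
  by [].
have gE (k : 'I_n) : g k = Z.of_nat (2 * kappa (fun j => d j k)).
  by rewrite /g column_rows kap2_prof // => j j' jj; apply: dm.
have sumE (t : seq 'I_n) : foldr (fun k s => Z.add (g k) s) Z0 (map val t) =
    Z.of_nat (2 * \sum_(k <- t) kappa (fun j => d j k)).
  elim: t => [|k t IHt]; first by rewrite big_nil.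
  by rewrite /= IHt big_cons gE; lia.
have cutE t : (forall k, k \in t -> g k = Z0) ->
    foldr (fun k s => Z.add (g k) s) Z0 t = Z0.
  elim: t => [|k t IHt] //= t0; rewrite t0 ?mem_head // IHt //.
  by move=> i it; apply: t0; rewrite in_cons it orbT.
rewrite /bound21 -(big_enum _ _ _ (fun k => kappa (fun j => d j k))) /= -sumE val_enum_ord.
rewrite /column_value -/K -/g -[in RHS](subnKC K_le) iotaD foldr_cat (cutE (iota _ _)) //.
by move=> k; rewrite mem_iota => /andP[Kk _]; apply: g0.
Qed.

Lemma value22_rows : value22 L' = bound22 d.
Proof.
pose T (j j' k k' : nat) : nat := if ((j <= j') && (k <= k'))%N then
      num22c (level_of L' j k) (level_of L' j k') (level_of L' j' k) (level_of L' j' k')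
        (j == j') (k == k') else 0%N.
have lR j k : (size L' <= j)%N -> level_of L' j k = 0%N.
  by move=> Rj; rewrite /level_of nth_default.
have lK j k : (K <= k)%N -> level_of L' j k = 0%N.
  move=> Kk; have [Rj|jR] := leqP (size L') j; first exact: lR.
  rewrite /level_of /plev; have [h1 h2 h3] := head_max (mem_nth p0 jR).
  by rewrite !ltnNge (leq_trans h1 Kk) (leq_trans h2 Kk) (leq_trans h3 Kk).
have num0 w x ej ek : num22c w x 0 0 ej ek = 0%N by [].
have num0' w y ej ek : num22c w 0 y 0 ej ek = 0%N.
  by rewrite /num22c /det22 /= ?andbF.
have TR' j j' k k' : (size L' <= j')%N -> T j j' k k' = 0%N.
  by move=> Rj; rewrite /T !(lR j') // num0; case: ifP.
have TR j j' k k' : (size L' <= j)%N -> T j j' k k' = 0%N.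
  by move=> Rj; rewrite /T; case: ifP => // /andP[jj _]; rewrite !(lR j') ?num0 // (leq_trans Rj).
have TK' j j' k k' : (K <= k')%N -> T j j' k k' = 0%N.
  by move=> Kk; rewrite /T !(lK _ k') // num0'; case: ifP.
have TK j j' k k' : (K <= k)%N -> T j j' k k' = 0%N.
  by move=> Kk; rewrite /T; case: ifP => // /andP[_ kk]; rewrite !(lK _ k') ?num0' // (leq_trans Kk).
have s0 (t : seq nat) (G : nat -> nat) : (forall j, G j = 0%N) -> sumn [seq G j | j <- t] = 0%N.
  by move=> G0; elim: t => //= j t ->; rewrite G0.
have -> : bound22 d = (\sum_(j < n) \sum_(j' < n) \sum_(k < n) \sum_(k' < n) T j j' k k')%N.
  apply: eq_bigr => j _; apply: eq_bigr => j' _; apply: eq_bigr => k _.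
  apply: eq_bigr => k' _; rewrite /T !level_of_rows num22E.
  by rewrite -(inj_eq val_inj j) -(inj_eq val_inj k).
have E (j j' k : 'I_n) : (\sum_(k' < n) T j j' k k' = sumn [seq T j j' k k' | k' <- iota 0 K])%N.
  by apply: sum_cut => [|k' Kk]; [exact: K_le | exact: TK'].
have E2 (j j' : 'I_n) : (\sum_(k < n) \sum_(k' < n) T j j' k k' =
    sumn [seq sumn [seq T j j' k k' | k' <- iota 0 K] | k <- iota 0 K])%N.
  rewrite (eq_bigr _ (fun k _ => E j j' k)).
  apply: (@sum_cut (fun k => sumn [seq T j j' k k' | k' <- iota 0 K])) => [|k Kk]; first exact: K_le.
  by apply: s0 => k'; apply: TK.
have E3 (j : 'I_n) : (\sum_(j' < n) \sum_(k < n) \sum_(k' < n) T j j' k k' =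
    sumn [seq sumn [seq sumn [seq T j j' k k' | k' <- iota 0 K] | k <- iota 0 K]
         | j' <- iota 0 (size L')])%N.
  rewrite (eq_bigr _ (fun j' _ => E2 j j')).
  apply: (@sum_cut (fun j' => sumn [seq sumn [seq T j j' k k' | k' <- iota 0 K] | k <- iota 0 K]))
    => [|j' Rj]; first exact: size_rows.
  by apply: (s0) => k; apply: (s0) => k'; apply: TR'.
rewrite (eq_bigr _ (fun j _ => E3 j)) (@sum_cut (fun j => sumn [seq sumn [seq sumn
   [seq T j j' k k' | k' <- iota 0 K] | k <- iota 0 K] | j' <- iota 0 (size L')]) (size L')) //.
  exact: size_rows.
by move=> j Rj; apply: (s0) => j'; apply: (s0) => k; apply: (s0) => k'; apply: TR.
Qed.

Lemma not_excluded : ~~ excluded n rho L'.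
Proof.
rewrite /excluded value22_rows column_value_rows negb_or -leqNgt.
case: ad => [_ ds [h _] [h' _]]; apply/andP; split; last exact: leq_trans ds h'.
by apply/Z.ltb_spec0; have := leq_trans ds h; rewrite -/rho; lia.
Qed.

End Trim.

Lemma first_row_gt0 : (0 < m)%N.
Proof.
rewrite lt0n; apply/negP => /eqP m0.
have k0 i : kappa (d i) = 0%N.
  suff : Z.of_nat (2 * kappa (d i)) = Z0 by lia.
  rewrite -(kap2_prof (d3 i) (@row_mono i)).
  have -> : prof (d i) = p0 by apply: psum_eq0; apply/eqP; rewrite -leqn0 -m0; exact: row_le.
  by [].
by have := sum_kappa; rewrite (eq_bigr _ (fun i _ => k0 i)) big1.
Qed.

Lemma check_sound_rows prune : ~~ check n rho prune.
Proof.
apply/negP => /allP/(_ m); rewrite mem_iota.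
have rc := first_row_col; have m0 := first_row_gt0.
have -> : (1 <= m < 1 + (rho + 3)./2)%N by move: mM rc m0; move: m M rho; lia.
move=> /(_ isT) /andP[c1].
have mn : prune -> (7 * m + 3 <= 6 * n)%N by move=> pr; move: c1; rewrite pr.
have pos : prune -> forall p, p \in L -> Z.le 0 (loss n m p).
  move=> pr _ /mapP[i _ ->]; apply: loss_ge0; first exact: mn.
    exact: prof_chain.
  exact: row_le.
have zl := zsum_loss.
have bm : Z.le (budget n rho m M) (budget n rho m m).
  by rewrite /budget; move: mM; move: m M rho => m1 M1 r1; nia.
have LE : L = row ord0 :: behead L by rewrite /L enum_ordSl.
case: ifP => [/andP[pr /Z.ltb_spec0 top0]|_].
  by have := zsum_ge0 (pos pr); lia.
have rowQ p : p \in L -> (0 < psum p)%N -> p \in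
    [seq p <- profiles m | (0 < psum p)%N && (~~ prune || Z.leb (loss n m p) (budget n rho m m))].
  move=> pL p00; rewrite mem_filter p00 /=; apply/andP; split.
    case pr: prune => //=; apply/Z.leb_spec0.
    have pos' := pos pr; suff : Z.le (loss n m p) (zsum (loss n m) L) by lia.
    elim: L pL pos' => [|q l IHl] //=; rewrite in_cons => /orP[/eqP <-|pl] pos'.
      have : Z.le 0 (zsum (loss n m) l); last by lia.
      by apply: zsum_ge0 => r rl; apply: pos'; rewrite in_cons rl orbT.
    have := pos' q (mem_head _ _).
    have : Z.le (loss n m p) (zsum (loss n m) l); last by lia.
    by apply: IHl => // r rl; apply: pos'; rewrite in_cons rl orbT.
  have /mapP[i _ ->] := pL.
  by apply: mem_profiles; [exact: prof_chain | exact: row_le].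
have r0m : psum (row ord0) = m by apply: psum_row.
have r0M : (pfst (row ord0) <= M)%N by rewrite pfst_row /M big_ord_recl leq_addr.
move/allP/(_ M); rewrite mem_iota.
have -> : (m <= M < m + (rho + 4 - m - m))%N by move: mM rc m0; move: m M rho; lia.
have r0L : row ord0 \in L by rewrite LE mem_head.
move=> /(_ isT) /allP/(_ _ (rowQ _ r0L _)); rewrite r0m eqxx r0M => /(_ m0) /= sr.
have sumL (f : profile -> nat) (t : seq 'I_n) :
    sumn (map f (map row t)) = (\sum_(i <- t) f (row i))%N.
  by rewrite sumnE !big_map.
have sL : sumn (map psum L) = rho.
  by rewrite sumL big_enum; apply: eq_bigr => i _; apply: psum_row.
have fL : sumn (map pfst L) = M.
  by rewrite sumL big_enum; apply: eq_bigr => i _; apply: pfst_row.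
have subL p : p \in behead L -> p \in L by rewrite LE in_cons => ->; rewrite orbT.
have [||||||L'' [k [LE' lf]]] := @search_sound n m prune _ _ rho (behead L) _ _ _ _ _
    row_chain _ _ _ _ _ _ sr.
- by move=> p /subL; apply: rowQ.
- by move: sL; rewrite LE /= r0m; lia.
- by move: fL; rewrite LE /=; lia.
- by move: zl; rewrite LE /=; lia.
- by move=> pr p /subL; apply: pos.
- by lia.
by have := @not_excluded (row ord0 :: L'') k; rewrite lf => /(_ _ isT)/implyP; rewrite LE LE' => /(_ erefl).
Qed.

End Rows.

Theorem check_sound n' (d : 'I_n'.+1 -> 'I_n'.+1 -> nat) s prune : admissible d s ->
  ~~ check n'.+1 (total d) prune.
Proof.
move=> ad; have [h|/ltnW h] := leqP (\sum_k d ord0 k) (\sum_j d j ord0).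
  exact: check_sound_rows ad h _.
by rewrite -(total_transpose d); apply: check_sound_rows (admissible_transpose ad) h _.
Qed.

Theorem admissible_ge n' (d : 'I_n'.+1 -> 'I_n'.+1 -> nat) s : admissible d s ->
  (7 * ((total d + 3)./2) + 3 <= 6 * n'.+1)%N ->
  (18 * (n'.+1 * n'.+1) <= total d * total d + (12 * n'.+1 + 6) * total d)%N.
Proof.
move=> ad small; wlog mM : d ad small / (\sum_k d ord0 k <= \sum_j d j ord0)%N => [H|].
  have [|/ltnW] := leqP (\sum_k d ord0 k) (\sum_j d j ord0); first exact: H ad small.
  rewrite -(total_transpose d) => h; apply: H (admissible_transpose ad) _ h.
  by rewrite total_transpose.
apply: (plain_bound ad mM); have := first_row_col ad.
move: mM small; set a := (\sum_k _)%N; set b := (\sum_j _)%N; move: (total d) a b => r a b; lia.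
Qed.

(** * Lower bounds for the border rank *)

Lemma matmulE (K : numFieldType) u v w t :
  matmul K u v w t = ((t.1.1.1 == t.2.2) && (t.1.1.2 == t.1.2.1) && (t.1.2.2 == t.2.1))%:R.
Proof.
case: t => [[[i j] [j' k]] [k' i']] /=.
rewrite /matmul sum_ffunE (bigD1 i) //= [X in _ + X]big1 ?addr0; last first.
  move=> i0 ii; rewrite sum_ffunE big1 // => j0 _; rewrite sum_ffunE big1 // => k0 _.
  by rewrite !ffunE !xpair_eqE [i == i0]eq_sym (negbTE ii) /= !mul0r.
rewrite sum_ffunE (bigD1 j) //= [X in _ + X]big1 ?addr0; last first.
  move=> j0 jj; rewrite sum_ffunE big1 // => k0 _.
  by rewrite !ffunE !xpair_eqE [j == j0]eq_sym (negbTE jj) /= andbF !mul0r.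
rewrite sum_ffunE (bigD1 k) //= [X in _ + X]big1 ?addr0; last first.
  move=> k0 kk.
  by rewrite !ffunE !xpair_eqE [k == k0]eq_sym (negbTE kk) /= andbF mulr0 mul0r.
rewrite !ffunE /= !xpair_eqE !eqxx /= mul1r andbT -natrM mulnb.
by rewrite [j' == j]eq_sym [k' == k]eq_sym [i' == i]eq_sym; congr (nat_of_bool _)%:R;
   case: (i == i'); case: (j == j'); case: (k == k').
Qed.

Section LowerBounds.
Variables (R : realType) (n' : nat).
Notation n := n'.+1.
Notation br := (border_rank (matmul R[i] 2 n n)).

Lemma is_idv_slice_span f : is_idv f -> slice_span (matmul R[i] 2 n n) f.
Proof.
case=> m ->; exists (fun q => m q.1 q.2); apply/ffunP => -[[i j] [k i']].
rewrite !ffunE /= (bigD1 (j, k)) //= matmulE /= !eqxx !andbT big1 ?addr0; last first.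
  move=> [j0 k0] jk; rewrite matmulE /=; move: jk; rewrite xpair_eqE.
  by rewrite [j0 == j]eq_sym; do 3 (case: (_ == _)); rewrite //= mulr0.
by rewrite mulrC.
Qed.

Lemma border_rank_admissible : exists (d : 'I_n -> 'I_n -> nat) s,
  admissible d s /\ (s <= br)%N.
Proof.
rewrite /border_rank; case: ex_minnP => r /asboolP + _.
case/border_apolarity => s [E [sr [dE LE t1 t2 t3]]].
have [] := @apolar_levels R[i] n _ E s.
- by rewrite pnatr_eq0.
- by split=> // f /is_idv_slice_span; apply: LE.
move=> d [md ds lt]; exists d, s; split=> //.
exact: tests_admissible lt.
Qed.

(** The total [rho] of the levels is the only quantity that the numerical estimates
    below need to know. *)
Lemma border_rank_excess : exists rho, [/\ (n * n + rho <= br)%N,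
  forall prune, ~~ check n rho prune &
  (7 * (rho + 3)./2 + 3 <= 6 * n)%N -> (18 * (n * n) <= rho * rho + (12 * n + 6) * rho)%N].
Proof.
have [d [s [ad sr]]] := border_rank_admissible; exists (total d); split.
- by case: ad => _ ds _ _; apply: leq_trans ds sr.
- by move=> prune; apply: check_sound ad.
exact: admissible_ge ad.
Qed.

End LowerBounds.

(** For [n] at most 54 the values of the excess that are too small are excluded one
    by one. The quadratic inequality is tried first; where it fails, the diagrams
    are enumerated. Losses need not be nonnegative when [n <= 6], which forbids
    pruning. *)
Section Certificates.
Variable n : nat.
Local Open Scope Z_scope.

Definition excess_excluded rho : bool :=
  let r := Z.of_nat rho in let z := Z.of_nat n in
  if Z.leb (7 * ((r + 3) / 2) + 3) (6 * z) && Z.ltb (r * r + (12 * z + 6) * r) (18 * (z * z))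
  then true else check n rho (6 < n)%N.

Definition excess_ge k := all excess_excluded (iota 0 k).

End Certificates.

Lemma half_small r n : (7 * r + 27 <= 12 * n)%N -> (7 * (r + 3)./2 + 3 <= 6 * n)%N.
Proof. by rewrite -divn2; lia. Qed.

Section Consequences.
Variables (R : realType) (n' : nat).
Notation n := n'.+1.
Notation br := (border_rank (matmul R[i] 2 n n)).

Lemma excess_ge_sound k : excess_ge n k -> (n * n + k <= br)%N.
Proof.
have [rho [le_br chk plain]] := border_rank_excess R n'.
move=> /allP ex; apply: leq_trans le_br; rewrite leq_add2l leqNgt; apply/negP => rk.
have := ex rho; rewrite mem_iota /= add0n => /(_ rk).
rewrite /excess_excluded; case: ifP => [/andP[/Z.leb_spec0 h1 /Z.ltb_spec0 h2] _|_].
  have : (7 * (rho + 3)./2 + 3 <= 6 * n)%N.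
    move: h1; have -> : Z.div (Z.of_nat rho + 3) 2 = Z.of_nat ((rho + 3)./2).
      rewrite -divn2; symmetry.
      by apply: (Z.div_unique _ _ _ (Z.of_nat ((rho + 3) %% 2))); lia.
    lia.
  move/plain; lia.
by rewrite (negbTE (chk _)).
Qed.

(** With slope 1.32 in place of [3 * sqrt 6 - 6] the quadratic inequality fails for
    all [n] from 55 on. *)
Lemma border_rank_large : (55 <= n)%N -> (132 * n + 100 <= 100 * (br - n * n))%N.
Proof.
have [rho [le_br _ plain]] := border_rank_excess R n'.
move=> n55; suff : (132 * n + 100 <= 100 * rho)%N by move: le_br; move: br (n * n)%N => b q; lia.
rewrite leqNgt; apply/negP => lt.
have := plain _; move: n55 lt; set N := n; clearbody N; move=> n55 lt.
have -> : (7 * (rho + 3)./2 + 3 <= 6 * N)%N by apply: half_small; lia.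
by move=> /(_ isT); nia.
Qed.

(** Writing [c] for [3 * sqrt 6 - 6], the positive root of [c ^ 2 + 12 * c = 18], an
    excess below [(c - e) * n + 1] falls short of the quadratic inequality by
    [n * (n * e * (6 * sqrt 6 - e) - 6 * (c + 12 - e))] up to terms of the right
    sign, and the hypothesis makes this positive. *)
Lemma border_rank_real (e : R) : 0 < e < 1 / 4 ->
  6 / e * ((3 * Num.sqrt 6 + 6 - e) / (6 * Num.sqrt 6 - e)) < n%:R ->
  n%:R ^+ 2 + (3 * Num.sqrt 6 - 6 - e) * n%:R + 1 <= br%:R.
Proof.
move=> /andP[e0 e4]; set q := Num.sqrt 6; have q2 : q * q = 6 by rewrite -expr2 sqr_sqrtr.
have q0 : 0 <= q by apply: sqrtr_ge0.
have [ql qu] : 244 / 100 < q /\ q < 245 / 100 by split; nra.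
have [rho [le_br _ plain]] := border_rank_excess R n'.
have d0 : 0 < 6 * q - e by lra.
rewrite mulf_div ltr_pdivrMr ?mulr_gt0 // => ne.
suff rge : (3 * q - 6 - e) * n%:R + 1 <= rho%:R :> R.
  move: le_br; rewrite -(ler_nat R) natrD natrM expr2; lra.
rewrite leNgt; apply/negP => lt.
have n22 : (22 <= n)%N.
  rewrite leqNgt; apply/negP; rewrite ltnS -(ler_nat R) => n21.
  have : n%:R * (e * (6 * q - e)) <= 21 * (e * (6 * q - e)) :> R.
    by rewrite ler_wpM2r // mulr_ge0 //; lra.
  by move: ne; nra.
have nR : 22 <= n%:R :> R by rewrite (ler_nat R 22).
have small : (7 * (rho + 3)./2 + 3 <= 6 * n)%N.
  have : (7 * rho%:R + 27 <= 12 * n%:R :> R) by nra.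
  by rewrite -(natrM _ 7) -(natrM _ 12) -natrD ler_nat; apply: half_small.
have := plain small; rewrite -(ler_nat R) !(natrD, natrM).
set x := (rho%:R : R) in lt *; set N := (n%:R : R) in nR ne lt *.
have x0 : 0 <= x by rewrite ler0n.
set X := (3 * q - 6 - e) * N + 1 in lt.
have : x * x + (12 * N + 6) * x < X * X + (12 * N + 6) * X by nra.
have -> : X * X + (12 * N + 6) * X =
   18 * (N * N) - N * (N * (e * (6 * q - e)) - 6 * (3 * q + 6 - e))
   - N * (96 - 6 * q + 2 * e - 24) + 7 + 9 * (q * q - 6) * (N * N).
  by rewrite /X; ring.
rewrite q2 subrr mulr0 mul0r addr0.
move=> h1 h2.
have : 0 <= N * (N * (e * (6 * q - e)) - 6 * (3 * q + 6 - e)) by rewrite mulr_ge0 //; lra.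
nra.
Qed.

End Consequences.

Lemma excess_table : all (fun n => excess_ge n (beta n - n * n)) (iota 4 21).
Proof. by vm_compute. Qed.

(* The quotient is [1.32 * n + 1] rounded up. *)
Lemma excess_linear : all (fun n => excess_ge n ((132 * n + 199) %/ 100)) (iota 25 30).
Proof. by vm_compute. Qed.

Lemma excess_3 : excess_ge 3 5.
Proof. by vm_compute. Qed.

Local Open Scope classical_set_scope.
Local Open Scope ring_scope.

(** * A degeneration to the tensor of format 2, 3, 3 *)

Section Degeneration.
Variable R : realType.
Notation K := (R[i] : numFieldType).

Definition eps m : K := m.+1%:R^-1.

Lemma eps_neq0 m : eps m != 0.
Proof. by rewrite invr_neq0 // pnatr_eq0. Qed.

Lemma eps_cvg0 : eps m @[m --> \oo] --> (0 : K).
Proof.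
apply/cvgrPdist_lt => e e0.
have er : e = ((complex.Re e)%:C)%C.
  by case: e e0 => x y /=; rewrite ltcE /= => /andP[/eqP -> _].
have re0 : 0 < complex.Re e by move: e0; rewrite {1}er ltcR.
near=> m; rewrite sub0r normrN ger0_norm ?invr_ge0 ?ler0n // /eps.
rewrite invf_plt ?posrE ?ltr0n //.
rewrite er -[m.+1%:R](rmorph_nat (real_complex R)) -fmorphV ltcR.
rewrite (lt_le_trans (Num.Theory.truncnS_gt _)) // ler_nat ltnS.
by near: m; exact: nbhs_infty_ge.
Unshelve. all: by end_near. Qed.

Lemma eps_exp_cvg0 k : eps m ^+ k.+1 @[m --> \oo] --> (0 : K).
Proof.
elim: k => [|k IHk]; first exact: eps_cvg0.
rewrite -[X in _ --> X](mulr0 (0 : K)).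
under eq_fun do rewrite exprS.
by apply: cvgM => //; exact: eps_cvg0.
Qed.

(** Scaling the coordinates of the factors by powers of [eps] multiplies the entry
    at [(i, j, l)] by [eps] to its weight. A tensor of rank at most [r] without
    entries of negative weight thus degenerates to its part of weight zero. *)
Lemma degeneration (I J L : finType) r (a : 'I_r -> I -> int) (b : 'I_r -> J -> int)
    (c : 'I_r -> L -> int) (wI : I -> int) (wJ : J -> int) (wL : L -> int)
    (T : tensor K I J L) :
  (forall p, exists i, a p i != 0) -> (forall p, exists j, b p j != 0) ->
  (forall p, exists l, c p l != 0) ->
  (forall i j l, let s := \sum_p a p i * b p j * c p l in
     let w := wI i + wJ j + wL l in
     [/\ (w < 0 -> s = 0), (w <= 0 -> T (i, j, l) = s%:~R) &
         (0 < w -> T (i, j, l) = 0)]) ->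
  limit_of_rank r T.
Proof.
move=> a0 b0 c0 H.
pose v (X : finType) (f : 'I_r -> X -> int) (w : X -> int) m p : {ffun X -> K} :=
  [ffun x => eps m ^ w x * (f p x)%:~R].
have v0 (X : finType) (f : 'I_r -> X -> int) w m p : (exists x, f p x != 0) -> v X f w m p != 0.
  case=> x fx; apply/eqP => /ffunP /(_ x); rewrite !ffunE => /eqP.
  by rewrite mulf_eq0 intr_eq0 (negbTE fx) orbF expfz_eq0 (negbTE (eps_neq0 m)) andbF.
exists (fun m => \sum_p tprod (v _ a wI m p) (v _ b wJ m p) (v _ c wL m p)); split.
  move=> m; exists (fun p => tprod (v _ a wI m p) (v _ b wJ m p) (v _ c wL m p)).
  split=> // p; exists (v _ a wI m p), (v _ b wJ m p), (v _ c wL m p).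
  by split=> //; apply: v0.
move=> [[i j] l].
have [] := H i j l; set s := \sum_p _; set w := _ + _ + _ => /= w1 w2 w3.
have -> : (fun m => (\sum_p tprod (v _ a wI m p) (v _ b wJ m p) (v _ c wL m p)) (i, j, l))
    = (fun m => eps m ^ w * s%:~R).
  apply/funext => m; rewrite sum_ffunE /s raddf_sum mulr_sumr.
  apply: eq_bigr => p _; rewrite !ffunE /= /w !expfzDr ?eps_neq0 // !intrM; ring.
case: (ltrgtP w 0) => [wn|wp|w0].
- rewrite w2 ?ltW // w1 // mulr0z; under eq_fun do rewrite mulr0.
  exact: (@cvg_cst K).
- rewrite w3 //; case: w wp {w1 w2 w3} => // [[|k]] // _.
  rewrite -[X in _ --> X](mul0r (s%:~R : K)).
  by apply: cvgM; [exact: eps_exp_cvg0 | exact: (@cvg_cst K)].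
rewrite w2 ?w0 //; under eq_fun do rewrite expr0z mul1r.
exact: (@cvg_cst K).
Qed.

End Degeneration.

(** Fourteen products, given by the coefficients of their three factors, with
    weights on the rows and columns of the three matrices. The entries of their sum
    that have weight zero are those of the matrix multiplication tensor, and those
    of negative weight cancel. The coefficients come from a numerical search
    followed by rounding. *)
Section Algorithm233.

Definition digits (M : seq (seq int)) (w : nat) (p i j : nat) : int :=
  nth 0 (nth [::] M p) (i * w + j)%N.

Definition alg_x := digits [::
  [:: 1; 0; -1; 0; 0; 0];
  [:: 1; 1; 0; 1; 0; 0];
  [:: 1; 1; 0; 1; 1; 0];
  [:: 1; 1; 0; 0; 0; 0];
  [:: 0; 0; 0; 0; -1; 1];
  [:: 0; 0; 1; 0; 1; 1];
  [:: 0; 0; 0; 0; 1; 0];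
  [:: 0; 1; 1; 0; 1; 0];
  [:: 0; 0; 1; 0; 0; 1];
  [:: 0; 0; 0; 1; 0; 1];
  [:: 0; 0; 1; -1; 0; 0];
  [:: 0; 0; 1; 1; 1; 1];
  [:: 1; 1; 0; 0; 0; 1];
  [:: 0; -1; 0; 1; 1; 1]] 3.

Definition alg_y := digits [::
  [:: 0; 1; -1; 1; 0; 0; 0; 0; 0];
  [:: 1; 0; 0; 0; 0; -1; -1; 0; 0];
  [:: 0; 0; 0; 0; 0; 1; 0; 0; 0];
  [:: -1; 0; 1; 0; 0; 0; 0; 0; 0];
  [:: 0; 0; 1; 0; 0; 0; 0; 0; 0];
  [:: 0; -1; 0; 0; 1; 0; -1; -1; 0];
  [:: 0; 0; 1; 1; 0; -1; 0; 0; 0];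
  [:: 0; 0; 1; 0; -1; 0; 0; 0; 0];
  [:: 0; 0; 1; 0; 0; 0; 0; 1; -1];
  [:: 0; 0; 1; 0; -1; 0; 0; 0; 1];
  [:: 0; 0; 0; 0; -1; 0; 1; -1; 1];
  [:: 0; 1; -1; 0; 0; 0; 0; 1; 0];
  [:: 0; 0; -1; 0; 0; 0; 1; 0; 0];
  [:: -1; 0; 1; 1; -1; 0; 1; 0; 0]] 3.

Definition alg_z := digits [::
  [:: 0; 0; 1; 0; 0; 0];
  [:: 1; 1; 0; 1; -1; 1];
  [:: 1; 1; 0; 1; 0; 1];
  [:: 0; 1; 1; 1; 1; 1];
  [:: 0; 1; 0; 0; 1; 0];
  [:: -1; 0; 0; 1; 0; 0];
  [:: 1; 1; 0; 1; 0; 0];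
  [:: -1; 0; 0; 0; 0; 0];
  [:: 0; 0; 0; 1; 0; 0];
  [:: 0; 0; 0; 1; 0; 1];
  [:: 0; 0; 0; 1; 1; 0];
  [:: -1; 0; 1; 1; 0; 0];
  [:: 0; 1; 0; 1; 0; 1];
  [:: -1; 0; 1; 0; 1; 0]] 2.

Definition wt_u i : int := nth 0 [:: 0; 2] i.
Definition wt_v j : int := nth 0 [:: 4; 5; 5] j.
Definition wt_w k : int := nth 0 [:: 1; 2; 3] k.

Definition alg_ok : bool :=
  all (fun i => all (fun j => all (fun j' => all (fun k => all (fun k' => all (fun i' =>
    let s := foldr (fun p t => alg_x p i j * alg_y p j' k * alg_z p k' i' + t) 0 (iota 0 14) in
    let w := wt_u i - wt_v j + (wt_v j' - wt_w k) + (wt_w k' - wt_u i') in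
    let e := (i == i') && (j == j') && (k == k') in
    [&& (0 <= w) || (s == 0), (0 < w) || (s == e%:R) & (w <= 0) || ~~ e])
  (iota 0 2)) (iota 0 3)) (iota 0 3)) (iota 0 3)) (iota 0 3)) (iota 0 2).

Definition alg_nonzero (f : nat -> nat -> nat -> int) a b : bool :=
  all (fun p => has (fun i => has (fun j => f p i j != 0) (iota 0 b)) (iota 0 a)) (iota 0 14).

End Algorithm233.

Lemma alg_ok_true : alg_ok. Proof. by vm_compute. Qed.

Lemma alg_okP (i : 'I_2) (j j' k k' : 'I_3) (i' : 'I_2) :
  let s := \sum_(p < 14) alg_x p i j * alg_y p j' k * alg_z p k' i' in
  let w := wt_u i - wt_v j + (wt_v j' - wt_w k) + (wt_w k' - wt_u i') in
  let e := (i == i') && (j == j') && (k == k') in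
  [/\ w < 0 -> s = 0, w <= 0 -> s = e%:R & 0 < w -> ~~ e].
Proof.
pose F (q : nat) := alg_x q i j * alg_y q j' k * alg_z q k' i'.
have -> : \sum_(p < 14) alg_x p i j * alg_y p j' k * alg_z p k' i' =
    foldr (fun p t => F p + t) 0 (iota 0 14).
  by rewrite -(big_mkord xpredT F) unlock.
have m2 (x : 'I_2) : nat_of_ord x \in iota 0 2 by rewrite mem_iota ltn_ord.
have m3 (x : 'I_3) : nat_of_ord x \in iota 0 3 by rewrite mem_iota ltn_ord.
have := alg_ok_true; rewrite /alg_ok.
move=> /allP/(_ _ (m2 i))/allP/(_ _ (m3 j))/allP/(_ _ (m3 j'))/allP/(_ _ (m3 k)).
move=> /allP/(_ _ (m3 k'))/allP/(_ _ (m2 i')).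
rewrite /F !(inj_eq val_inj).
set s := foldr _ _ _; set w := (_ + _ + _ : int); set e := (_ && _ && _).
move=> /and3P[h1 h2 h3]; split=> hw.
- by move: h1; rewrite leNgt hw /= => /eqP.
- by move: h2; rewrite ltNge hw /= => /eqP.
by move: h3; rewrite leNgt hw.
Qed.

Lemma alg_nonzeroP f a b : alg_nonzero f a b ->
  forall p : 'I_14, exists x : 'I_a * 'I_b, f p x.1 x.2 != 0.
Proof.
move=> /allP h p; have /h : nat_of_ord p \in iota 0 14 by rewrite mem_iota ltn_ord.
case/hasP=> i; rewrite mem_iota => /andP[_ ia] /hasP[j]; rewrite mem_iota => /andP[_ jb] fij.
by exists (Ordinal ia, Ordinal jb).
Qed.

Lemma border_rank_233 (R : realType) : (border_rank (matmul R[i] 2 3 3) <= 14)%N.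
Proof.
rewrite /border_rank; case: ex_minnP => r _; apply; apply/asboolP.
apply: (@degeneration R ('I_2 * 'I_3)%type ('I_3 * 'I_3)%type ('I_3 * 'I_2)%type 14
  (fun p x => alg_x p x.1 x.2) (fun p x => alg_y p x.1 x.2)
  (fun p x => alg_z p x.1 x.2) (fun x => wt_u x.1 - wt_v x.2)
  (fun x => wt_v x.1 - wt_w x.2) (fun x => wt_w x.1 - wt_u x.2)).
- exact: (@alg_nonzeroP alg_x 2 3).
- exact: (@alg_nonzeroP alg_y 3 3).
- exact: (@alg_nonzeroP alg_z 3 2).
move=> [i j] [j' k] [k' i'] s w /=; rewrite matmulE /=.
have [h1 h2 h3] := alg_okP i j j' k k' i'; split=> hw; first exact: h1.
  by rewrite /s h2 // rmorph_nat.
by rewrite (negbTE (h3 hw)).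
Qed.

(** * Border ranks of matrix multiplication *)

Theorem theorem1p4 (R : realType) :
  [/\ border_rank (matmul R[i] 2 3 3) = 14%N,
      (forall n : nat, (4 <= n <= 24)%N ->
         (beta n <= border_rank (matmul R[i] 2 n n))%N),
      (forall (e : R) (n : nat), 0 < e < 1 / 4 -> (0 < n)%N ->
         6 / e * ((3 * Num.sqrt 6 + 6 - e) / (6 * Num.sqrt 6 - e)) < n%:R ->
         n%:R ^+ 2 + (3 * Num.sqrt 6 - 6 - e) * n%:R + 1
           <= (border_rank (matmul R[i] 2 n n))%:R)
    & (forall n : nat, (25 <= n)%N ->
         n%:R ^+ 2 + 132 / 100 * n%:R + 1
           <= (border_rank (matmul R[i] 2 n n))%:R :> R)].
Proof.
split.
- apply/eqP; rewrite eqn_leq border_rank_233.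
  by have := excess_ge_sound R excess_3; rewrite addnC.
- case=> // n n4; have /allP/(_ n.+1) := excess_table; rewrite mem_iota.
  move=> /(_ n4)/(excess_ge_sound R); apply: leq_trans.
  by rewrite -leq_subLR.
- by move=> e [|n] // e4 _; apply: border_rank_real.
case=> // n n25; suff : (n.+1 * n.+1 * 100 + 132 * n.+1 + 100 <=
    100 * border_rank (matmul R[i] 2 n.+1 n.+1))%N.
  rewrite -(ler_nat R) !(natrD, natrM); set N := (n.+1%:R : R); set b := _%:R.
  by rewrite expr2; lra.
have [n55|n55] := leqP 55 n.+1.
  have := border_rank_large R n55; move: (border_rank _) => b.
  by move: (n.+1) n55 => N; nia.
have /allP/(_ n.+1) := excess_linear; rewrite mem_iota n25 n55 => /(_ isT)/(excess_ge_sound R).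
move: (border_rank _) => b; move: (n.+1) {n25 n55} => N h.
by have := divn_eq (132 * N + 199) 100; have := @ltn_mod (132 * N + 199) 100; nia.
Qed.
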